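(* The following is provable in $\mathbf{ZF}$ (no form of the Axiom of Choice is assumed). For every effectively normal generalized topological space $\mathbf{X}$, $\mathbf{GUL(X)}$ holds.
   Context: A generalized topology in a set $X$ is a collection $\mu$ of subsets of $X$ closed under arbitrary unions (so $\emptyset\in\mu$, but $X\in\mu$ is not required, nor is closure under finite intersections). A generalized topological space is a pair $\mathbf{X}=\langle X,\mu\rangle$ with $\mu$ a generalized topology in $X$. A set $A\subseteq X$ is $\mu$-open if $A\in\mu$ and $\mu$-closed if $X\setminus A\in\mu$. For generalized topological spaces $\langle X,\mu_X\rangle$, $\langle Y,\mu_Y\rangle$, a map $f:X\to Y$ is $\langle\mu_X,\mu_Y\rangle$-continuous if $f^{-1}[V]\in\mu_X$ for every $V\in\mu_Y$. For $\mathbf{X}=\langle X,\mu\rangle$ let $\mathcal{E}(\mathbf{X})=\{\langle A,B\rangle: A,B\text{ are }\mu\text{-closed and }A\cap B=\emptyset\}$ and $\mathcal{O}(\mathbf{X})=\{\langle U,V\rangle: U,V\text{ are }\mu\text{-open and }U\cap V=\emptyset\}$. $\mathbf{X}$ is effectively normal if there exists a function $F:\mathcal{E}(\mathbf{X})\to\mathcal{O}(\mathbf{X})$ such that, for every $\langle A,B\rangle\in\mathcal{E}(\mathbf{X})$, if $F(\langle A,B\rangle)=\langle U,V\rangle$, then $A\subseteq U$ and $B\subseteq V$. $g\tau_n=\{\emptyset,\mathbb{R}\}\cup\{(-\infty,a):a\in\mathbb{R}\}\cup\{(a,+\infty):a\in\mathbb{R}\}\cup\{(-\infty,a)\cup(b,+\infty):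 a,b\in\mathbb{R},\ a\leq b\}$, a generalized topology in $\mathbb{R}$. $\mathbf{GUL(X)}$ is the statement: for every pair $A,B$ of disjoint $\mu$-closed sets there exists a $\langle\mu,g\tau_n\rangle$-continuous $f:X\to\mathbb{R}$ with $A\subseteq f^{-1}[\{0\}]$ and $B\subseteq f^{-1}[\{1\}]$. *)

(* Defs.v *)
From Stdlib Require Import List.
Import ListNotations.

(** * First-order logic over the signature {∈, =}

    Variables are de Bruijn indices and are the only terms. *)

Inductive form : Set :=
| fBot : form
| fMem (i j : nat) : form
| fEq (i j : nat) : form
| fImp (p q : form) : form
| fAll (p : form) : form.

Definition up (s : nat -> nat) (n : nat) : nat :=
  match n with 0 => 0 | S k => S (s k) end.

Fixpoint ren (s : nat -> nat) (p : form) : form :=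
  match p with
  | fBot => fBot
  | fMem i j => fMem (s i) (s j)
  | fEq i j => fEq (s i) (s j)
  | fImp p q => fImp (ren s p) (ren s q)
  | fAll p => fAll (ren (up s) p)
  end.

Definition inst (t : nat) (p : form) : form :=
  ren (fun n => match n with 0 => t | S k => k end) p.

(** Classical natural deduction from a set [T] of axioms.  As [Gen] shifts the
    local hypotheses [H] but not [T], the free variables of an axiom are
    parameters: an axiom stands for its universal closure. *)
Inductive proves (T : form -> Prop) : list form -> form -> Prop :=
| Ax H p : T p -> proves T H p
| Hyp H p : In p H -> proves T H p
| ImpI H p q : proves T (p :: H) q -> proves T H (fImp p q)
| ImpE H p q : proves T H (fImp p q) -> proves T H p -> proves T H q
| Raa H p : proves T (fImp p fBot :: H) fBot -> proves T H p
| Gen H p : proves T (map (ren S) H) p -> proves T H (fAll p)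
| Spec H p t : proves T H (fAll p) -> proves T H (inst t p)
| EqRefl H i : proves T H (fEq i i)
| EqSubst H i j p :
    proves T H (fEq i j) -> proves T H (inst i p) -> proves T H (inst j p).

(** * Writing formulas with named bound variables

    An [expr] is a formula that has yet to be told the number [d] of enclosing
    quantifiers.  A [var] is the number of quantifiers enclosing its own
    binder (a de Bruijn level), which [idx] turns into an index. *)

Definition var := nat.
Definition expr := nat -> form.
Definition idx (d : nat) (x : var) : nat := d - S x.

Definition bot : expr := fun _ => fBot.
Definition mem (x y : var) : expr := fun d => fMem (idx d x) (idx d y).
Definition eqv (x y : var) : expr := fun d => fEq (idx d x) (idx d y).
Definition imp (p q : expr) : expr := fun d => fImp (p d) (q d).
Definition all (p : var -> expr) : expr := fun d => fAll (p d (S d)).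

Definition neg (p : expr) : expr := imp p bot.
Definition conj (p q : expr) : expr := neg (imp p (neg q)).
Definition disj (p q : expr) : expr := imp (neg p) q.
Definition iff (p q : expr) : expr := conj (imp p q) (imp q p).
Definition ex (p : var -> expr) : expr := neg (all (fun x => neg (p x))).
Definition allin (A : var) (p : var -> expr) : expr :=
  all (fun x => imp (mem x A) (p x)).
Definition exin (A : var) (p : var -> expr) : expr :=
  ex (fun x => conj (mem x A) (p x)).

(** [app p [x0; ..; xk]] substitutes xi for the index i in [p]; the remaining
    free variables of [p] are shifted past all enclosing quantifiers, so that
    they stay free. *)
Definition app (p : form) (xs : list var) : expr := fun d =>
  ren (fun n => match nth_error xs n with
                | Some x => idx d x
                | None => d + (n - length xs)
                end) p.

Definition sentence (p : expr) : form := p 0.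

Declare Scope zf_scope.
Delimit Scope zf_scope with zf.
Bind Scope zf_scope with expr.
Notation "x ∈ y" := (mem x y) (at level 70) : zf_scope.
Notation "x ≐ y" := (eqv x y) (at level 70) : zf_scope.
Notation "¬ p" := (neg p) (at level 75, right associativity) : zf_scope.
Notation "p ∧ q" := (conj p q) (at level 80, right associativity) : zf_scope.
Notation "p ∨ q" := (disj p q) (at level 85, right associativity) : zf_scope.
Notation "p ⟷ q" := (iff p q) (at level 95, no associativity) : zf_scope.
Notation "p ⟶ q" := (imp p q) (at level 99, right associativity) : zf_scope.
Notation "∀ x .. y , p" := (all (fun x => .. (all (fun y => p%zf)) ..))
  (at level 200, x binder, y binder, right associativity) : zf_scope.
Notation "∃ x .. y , p" := (ex (fun x => .. (ex (fun y => p%zf)) ..))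
  (at level 200, x binder, y binder, right associativity) : zf_scope.
Notation "∀[ x ∈ A ] p" := (allin A (fun x => p%zf))
  (at level 200, x name, A at level 9, right associativity) : zf_scope.
Notation "∃[ x ∈ A ] p" := (exin A (fun x => p%zf))
  (at level 200, x name, A at level 9, right associativity) : zf_scope.
Open Scope zf_scope.

(** * The axioms of ZF *)

Definition extensionality : expr := ∀ a b, (∀ x, x ∈ a ⟷ x ∈ b) ⟶ a ≐ b.

Definition foundation : expr :=
  ∀ a, (∃ x, x ∈ a) ⟶ ∃[x ∈ a] ¬ ∃[y ∈ x] y ∈ a.

Definition pairing : expr := ∀ a b, ∃ c, ∀ x, x ∈ c ⟷ x ≐ a ∨ x ≐ b.

Definition union : expr := ∀ a, ∃ u, ∀ x, x ∈ u ⟷ ∃[y ∈ a] x ∈ y.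

Definition powerset : expr := ∀ a, ∃ u, ∀ x, x ∈ u ⟷ ∀[y ∈ x] y ∈ a.

Definition infinity : expr :=
  ∃ w, (∃[e ∈ w] ∀ z, ¬ z ∈ e)
     ∧ ∀[x ∈ w] ∃[y ∈ w] ∀ z, z ∈ y ⟷ z ∈ x ∨ z ≐ x.

Definition separation (p : form) : expr :=
  ∀ a, ∃ b, ∀ x, x ∈ b ⟷ x ∈ a ∧ app p [x].

Definition replacement (p : form) : expr :=
  ∀ a, (∀[x ∈ a] ∀ y z, app p [x; y] ∧ app p [x; z] ⟶ y ≐ z)
       ⟶ ∃ b, ∀ y, y ∈ b ⟷ ∃[x ∈ a] app p [x; y].

Inductive ZF : form -> Prop :=
| ZF_ext : ZF (sentence extensionality)
| ZF_found : ZF (sentence foundation)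
| ZF_pair : ZF (sentence pairing)
| ZF_union : ZF (sentence union)
| ZF_power : ZF (sentence powerset)
| ZF_inf : ZF (sentence infinity)
| ZF_sep p : ZF (sentence (separation p))
| ZF_repl p : ZF (sentence (replacement p)).

Definition ZF_proves (p : expr) : Prop := proves ZF [] (sentence p).

(** * Basic set theory *)

Definition subset (A B : var) : expr := ∀[x ∈ A] x ∈ B.

Definition disjoint (A B : var) : expr := ¬ ∃[x ∈ A] x ∈ B.

Definition is_empty (A : var) : expr := ∀ x, ¬ x ∈ A.

Definition is_singleton (A x : var) : expr := ∀ z, z ∈ A ⟷ z ≐ x.

Definition is_upair (A x y : var) : expr := ∀ z, z ∈ A ⟷ z ≐ x ∨ z ≐ y.

(** p = {{x}, {x, y}} *)
Definition is_opair (p x y : var) : expr :=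
  ∀ z, z ∈ p ⟷ is_singleton z x ∨ is_upair z x y.

Definition opair_in (x y F : var) : expr := ∃[p ∈ F] is_opair p x y.

Definition is_bigunion (U S : var) : expr := ∀ x, x ∈ U ⟷ ∃[A ∈ S] x ∈ A.

Definition is_diff (C A B : var) : expr := ∀ x, x ∈ C ⟷ x ∈ A ∧ ¬ x ∈ B.

Definition is_prod (P A B : var) : expr :=
  ∀ p, p ∈ P ⟷ ∃[x ∈ A] ∃[y ∈ B] is_opair p x y.

Definition is_function (f A B : var) : expr :=
  (∀[p ∈ f] ∃[x ∈ A] ∃[y ∈ B] is_opair p x y)
  ∧ ∀[x ∈ A] ∃[y ∈ B] opair_in x y f ∧ ∀ z, opair_in x z f ⟶ z ≐ y.

(** W = f^{-1}[V], for f with domain X *)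
Definition is_preimage (W f X V : var) : expr :=
  ∀ x, x ∈ W ⟷ x ∈ X ∧ ∃[y ∈ V] opair_in x y f.

(** * The real line

    ZF proves that a complete ordered field exists and is unique up to
    isomorphism, so ℝ is taken to be an arbitrary one; [lt] is its strict
    order, a set of ordered pairs. *)

Definition is_binop (f R : var) : expr := ∃ P, is_prod P R R ∧ is_function f P R.

(** f(x, y) = z *)
Definition op (f x y z : var) : expr := ∃ p, is_opair p x y ∧ opair_in p z f.

Definition is_comm_monoid (R f e : var) : expr :=
  is_binop f R ∧ e ∈ R
  ∧ (∀[x ∈ R] op f x e x)
  ∧ (∀[x ∈ R] ∀[y ∈ R] ∀[z ∈ R] op f x y z ⟶ op f y x z)
  ∧ (∀[x ∈ R] ∀[y ∈ R] ∀[z ∈ R] ∀[u ∈ R] ∀[v ∈ R] ∀[w ∈ R]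
       op f x y u ⟶ op f y z v ⟶ op f u z w ⟶ op f x v w).

Definition is_field (R zero one add mul : var) : expr :=
  is_comm_monoid R add zero ∧ is_comm_monoid R mul one
  ∧ ¬ zero ≐ one
  ∧ (∀[x ∈ R] ∃[y ∈ R] op add x y zero)
  ∧ (∀[x ∈ R] ¬ x ≐ zero ⟶ ∃[y ∈ R] op mul x y one)
  ∧ (∀[x ∈ R] ∀[y ∈ R] ∀[z ∈ R] ∀[s ∈ R] ∀[u ∈ R] ∀[v ∈ R] ∀[w ∈ R]
       op add y z s ⟶ op mul x y u ⟶ op mul x z v ⟶ op mul x s w
       ⟶ op add u v w).

Definition is_linear_order (R lt : var) : expr :=
  (∀[x ∈ R] ¬ opair_in x x lt)
  ∧ (∀[x ∈ R] ∀[y ∈ R] ∀[z ∈ R]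
       opair_in x y lt ⟶ opair_in y z lt ⟶ opair_in x z lt)
  ∧ (∀[x ∈ R] ∀[y ∈ R] opair_in x y lt ∨ x ≐ y ∨ opair_in y x lt).

Definition le (lt x y : var) : expr := opair_in x y lt ∨ x ≐ y.

Definition upper_bound (lt S b : var) : expr := ∀[x ∈ S] le lt x b.

Definition is_complete_order (R lt : var) : expr :=
  ∀ S, subset S R ⟶ ¬ is_empty S ⟶ (∃[b ∈ R] upper_bound lt S b)
    ⟶ ∃[s ∈ R] upper_bound lt S s
               ∧ ∀[b ∈ R] upper_bound lt S b ⟶ le lt s b.

Definition is_real_line (R zero one add mul lt : var) : expr :=
  is_field R zero one add mul
  ∧ is_linear_order R lt
  ∧ (∀[x ∈ R] ∀[y ∈ R] ∀[z ∈ R] ∀[u ∈ R] ∀[v ∈ R]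
       opair_in x y lt ⟶ op add x z u ⟶ op add y z v ⟶ opair_in u v lt)
  ∧ (∀[x ∈ R] ∀[y ∈ R] ∀[z ∈ R]
       opair_in zero x lt ⟶ opair_in zero y lt ⟶ op mul x y z
       ⟶ opair_in zero z lt)
  ∧ is_complete_order R lt.

(** * Generalized topological spaces *)

Definition is_gentop (X mu : var) : expr :=
  (∀[U ∈ mu] subset U X)
  ∧ ∀ S, subset S mu ⟶ ∃[U ∈ mu] is_bigunion U S.

Definition closed_in (X mu A : var) : expr :=
  subset A X ∧ ∃[U ∈ mu] is_diff U X A.

Definition continuous (f X muX Y muY : var) : expr :=
  is_function f X Y ∧ ∀[V ∈ muY] ∃[W ∈ muX] is_preimage W f X V.

(** E = 𝓔(⟨X, mu⟩) *)
Definition is_closed_pairs (E X mu : var) : expr :=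
  ∀ p, p ∈ E ⟷ ∃ A B, is_opair p A B
                      ∧ closed_in X mu A ∧ closed_in X mu B ∧ disjoint A B.

(** O = 𝓞(⟨X, mu⟩) *)
Definition is_open_pairs (O mu : var) : expr :=
  ∀ p, p ∈ O ⟷ ∃ U V, is_opair p U V ∧ U ∈ mu ∧ V ∈ mu ∧ disjoint U V.

Definition effectively_normal (X mu : var) : expr :=
  ∃ E O F, is_closed_pairs E X mu ∧ is_open_pairs O mu ∧ is_function F E O
    ∧ ∀[p ∈ E] ∀ q, opair_in p q F ⟶
        ∀ A B U V, is_opair p A B ⟶ is_opair q U V ⟶ subset A U ∧ subset B V.

(** G = (-∞, a) *)
Definition is_left_ray (R lt G a : var) : expr :=
  ∀ x, x ∈ G ⟷ x ∈ R ∧ opair_in x a lt.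

(** G = (a, +∞) *)
Definition is_right_ray (R lt G a : var) : expr :=
  ∀ x, x ∈ G ⟷ x ∈ R ∧ opair_in a x lt.

(** G = (-∞, a) ∪ (b, +∞) *)
Definition is_two_rays (R lt G a b : var) : expr :=
  ∀ x, x ∈ G ⟷ x ∈ R ∧ (opair_in x a lt ∨ opair_in b x lt).

(** T = gτ_n *)
Definition is_gtau_n (R lt T : var) : expr :=
  ∀ G, G ∈ T ⟷
    is_empty G ∨ G ≐ R
    ∨ (∃[a ∈ R] is_left_ray R lt G a)
    ∨ (∃[a ∈ R] is_right_ray R lt G a)
    ∨ (∃[a ∈ R] ∃[b ∈ R] le lt a b ∧ is_two_rays R lt G a b).

(** A ⊆ f^{-1}[{r}] *)
Definition sub_fiber (A f X r : var) : expr :=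
  ∃ s W, is_singleton s r ∧ is_preimage W f X s ∧ subset A W.

(** GUL(X), where T = gτ_n *)
Definition GUL (X mu R zero one T : var) : expr :=
  ∀ A B, closed_in X mu A ⟶ closed_in X mu B ⟶ disjoint A B ⟶
    ∃ f, continuous f X mu R T ∧ sub_fiber A f X zero ∧ sub_fiber B f X one.

(* Main.v *)
From Stdlib Require Import List Arith Lia Cantor Classical ClassicalEpsilon
  FunctionalExtensionality PropExtensionality.
Require Import Defs.
Import ListNotations.

(** By [completeness] it suffices to prove the theorem in an arbitrary model [M]
    of ZF, where a set is an element of a Rocq type and the connectives are those
    of Rocq.  What the first-order setting leaves is the restriction of
    separation to definable predicates; the closure properties of [definable]
    discharge it by a syntactic traversal.

    Inside the model, Urysohn's lemma follows the usual dyadic scheme, arranged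
    so as to need neither natural numbers nor recursion.  Fix disjoint closed
    sets [A] and [B] and the function [F] that separates disjoint closed pairs.
    A node consists of an interval with end points [r < s] and a disjoint closed
    pair [C], [D]; it stands for the requirement that the future function be at
    least [r] off [C] and at most [s] off [D].  Let [m] be the midpoint of [r]
    and [s] and let [F] give [C] and [D] the open sets [V] and [W].  The node
    has the two children [r, m, C, X - V] and [m, s, X - W, D].
    The tree is the least set that contains [0, 1, A, B] and is closed under
    both operations, so choice is never used: [F] makes every decision.

    Two nodes of the tree are either related by descent or separated, one lying
    before the other ([tree_comparable]), so that a value forced from below
    never exceeds one forced from above ([tree_monotone]).  Every
    subinterval of the unit interval contains the interval of some node
    ([tree_dense]), by a supremum argument on the lengths of the intervals around
    a point.  Let [value x] be the least upper bound of 0 and all [r] such that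
    [x] avoids the [C] of some node.  For [a] in the unit interval, [value x > a]
    holds iff [x] avoids the [C] of a node with [r > a], and [value x < a] iff [x] avoids the [D] of a
    node with [s < a].  Both conditions define unions of open sets; as the proper
    open sets of the target are built from rays by unions alone, closure of
    [mu] under unions suffices for continuity. *)

(** * Renaming of variables *)

Definition scons {A : Type} (a : A) (s : nat -> A) (n : nat) : A :=
  match n with 0 => a | S k => s k end.
Notation "a .: s" := (scons a s) (at level 55, right associativity).

Lemma up_comp s s' : (fun n => up s (up s' n)) = up (fun n => s (s' n)).
Proof. apply functional_extensionality; intros [|n]; reflexivity. Qed.

Lemma ren_ren s s' p : ren s (ren s' p) = ren (fun n => s (s' n)) p.
Proof.
  revert s s'; induction p as [|i j|i j|p IHp q IHq|p IHp]; intros s s'; cbn;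
    try reflexivity.
  - now rewrite IHp, IHq.
  - now rewrite IHp, up_comp.
Qed.

Lemma up_id : up (fun n => n) = fun n => n.
Proof. apply functional_extensionality; intros [|n]; reflexivity. Qed.

Lemma ren_id p : ren (fun n => n) p = p.
Proof.
  induction p as [|i j|i j|p IHp q IHq|p IHp]; cbn; try reflexivity.
  - now rewrite IHp, IHq.
  - now rewrite up_id, IHp.
Qed.

Lemma inst_ren_up k s p : inst k (ren (up s) p) = ren (k .: s) p.
Proof.
  unfold inst; rewrite ren_ren; f_equal.
  apply functional_extensionality; intros [|n]; reflexivity.
Qed.

Lemma ren_inst k s p : ren s (inst k p) = ren (s k .: s) p.
Proof.
  unfold inst; rewrite ren_ren; f_equal.
  apply functional_extensionality; intros [|n]; reflexivity.
Qed.

Fixpoint fv_bound (p : form) : nat :=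
  match p with
  | fBot => 0
  | fMem i j | fEq i j => S (Nat.max i j)
  | fImp p q => Nat.max (fv_bound p) (fv_bound q)
  | fAll p => pred (fv_bound p)
  end.

Lemma ren_ext_bound p : forall s s',
  (forall k, k < fv_bound p -> s k = s' k) -> ren s p = ren s' p.
Proof.
  induction p as [|i j|i j|p IHp q IHq|p IHp]; cbn; intros s s' E.
  - reflexivity.
  - rewrite (E i), (E j) by lia; reflexivity.
  - rewrite (E i), (E j) by lia; reflexivity.
  - f_equal; [apply IHp | apply IHq]; intros k ?; apply E; lia.
  - f_equal; apply IHp; intros [|k] ?; cbn; [reflexivity | f_equal; apply E; lia].
Qed.

Definition list_fv_bound (H : list form) : nat :=
  fold_right (fun p n => Nat.max (fv_bound p) n) 0 H.

Lemma list_fv_bound_in H p : In p H -> fv_bound p <= list_fv_bound H.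
Proof.
  induction H as [|q H IH]; cbn; [tauto | intros [-> | i]]; [lia|].
  specialize (IH i); unfold list_fv_bound in IH; lia.
Qed.

(** * Structural properties of provability *)

Lemma weakening T H p :
  proves T H p -> forall H', incl H H' -> proves T H' p.
Proof.
  induction 1 as [| |H p q _ IH|H p q _ IH1 _ IH2|H p _ IH|H p _ IH|H p t _ IH
    |H i|H i j p _ IH1 _ IH2]; intros H' I.
  - now apply Ax.
  - now apply Hyp, I.
  - apply ImpI, IH. intros x [->|x']; [now left | right; now apply I].
  - eapply ImpE; [apply IH1 | apply IH2]; assumption.
  - apply Raa, IH. intros x [->|x']; [now left | right; now apply I].
  - apply Gen, IH. now apply incl_map.
  - now apply Spec, IH.
  - apply EqRefl.
  - eapply EqSubst; [apply IH1 | apply IH2]; assumption.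
Qed.

Lemma ax_gen T p n : proves T [] p -> proves T [] (Nat.iter n fAll p).
Proof. intros D; induction n; cbn; [assumption | now apply Gen]. Qed.

Lemma iter_all_ren n s p :
  ren s (Nat.iter n fAll p) = Nat.iter n fAll (ren (Nat.iter n up s) p).
Proof.
  revert s; induction n as [|n IH]; intros s; cbn; [reflexivity|].
  now rewrite IH, <- Nat.iter_succ_r.
Qed.

Lemma iter_up n s k :
  Nat.iter n up s k = if k <? n then k else n + s (k - n).
Proof.
  revert k; induction n as [|n IH]; intros k.
  - now rewrite Nat.sub_0_r.
  - rewrite Nat.iter_succ. destruct k as [|k]; [reflexivity|].
    cbn [up]; rewrite IH. change (S k <? S n) with (k <? n). now destruct (k <? n).
Qed.

(** Specializing the outermost quantifier first leaves the inner ones in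
    place, so the [k]-th of the [n] quantifiers receives [f k]. *)
Lemma ax_spec T n p (f : nat -> nat) :
  proves T [] (Nat.iter n fAll p) ->
  proves T [] (ren (fun k => if k <? n then f k else k - n) p).
Proof.
  revert p; induction n as [|n IH]; intros p D.
  - replace (fun k => _) with (fun k : nat => k); [now rewrite ren_id|].
    apply functional_extensionality; intros k; cbn; lia.
  - rewrite Nat.iter_succ in D; apply Spec with (t := f n) in D.
    unfold inst in D; rewrite iter_all_ren in D.
    apply IH in D; rewrite ren_ren in D.
    erewrite ren_ext_bound; [exact D|]; intros k _; cbn beta.
    rewrite iter_up.
    destruct (Nat.ltb_spec k n) as [l|l].
    + rewrite (proj2 (Nat.ltb_lt k (S n))) by lia.
      now rewrite (proj2 (Nat.ltb_lt k n)) by lia.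
    + rewrite (proj2 (Nat.ltb_ge _ n)) by lia.
      destruct (Nat.ltb_spec k (S n)) as [l'|l'].
      * replace k with n by lia. rewrite Nat.sub_diag. lia.
      * destruct (k - n) as [|j] eqn:E; lia.
Qed.

(** The free variables of an axiom can be instantiated at will: generalize
    all of them, then specialize. *)
Lemma ax_ren T p s : proves T [] p -> proves T [] (ren s p).
Proof.
  intros D. apply (ax_gen T p (fv_bound p)), (ax_spec T _ p s) in D.
  erewrite ren_ext_bound; [exact D|]; intros k l; cbn beta.
  now rewrite (proj2 (Nat.ltb_lt _ _) l).
Qed.

(** Needed for eigenvariables only: it turns a free variable that occurs
    nowhere else into the variable bound by [Gen]. *)
Lemma renaming T H p :
  proves T H p -> forall s, proves T (map (ren s) H) (ren s p).
Proof.
  induction 1 as [| |H p q _ IH|H p q _ IH1 _ IH2|H p _ IH|H p _ IH|H p t _ IH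
    |H i|H i j p _ IH1 _ IH2]; intros s.
  - apply weakening with (H := []); [|apply incl_nil_l]. now apply ax_ren, Ax.
  - now apply Hyp, in_map.
  - apply ImpI, (IH s).
  - eapply ImpE; [apply (IH1 s) | apply IH2].
  - apply Raa, (IH s).
  - cbn; apply Gen. specialize (IH (up s)).
    rewrite map_map in *. erewrite map_ext; [exact IH|].
    intros q; cbn; now rewrite !ren_ren.
  - rewrite ren_inst, <- inst_ren_up. apply Spec, (IH s).
  - apply EqRefl.
  - specialize (IH1 s); specialize (IH2 s).
    rewrite ren_inst, <- inst_ren_up in *. eapply EqSubst; eassumption.
Qed.

Lemma gen_fresh T H q y :
  list_fv_bound H <= y -> pred (fv_bound q) <= y ->
  proves T H (inst y q) -> proves T H (fAll q).
Proof.
  intros yH yq D. apply Gen.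
  (* the renaming that turns y into the bound variable and shifts the others *)
  set (s := fun n => if n =? y then 0 else S n).
  assert (Es : forall n, n < y -> s n = S n).
  { intros n l; unfold s. now rewrite (proj2 (Nat.eqb_neq n y)) by lia. }
  apply renaming with (s := s) in D.
  rewrite ren_inst in D.
  replace (ren (s y .: s) q) with q in D.
  - erewrite map_ext_in; [exact D|]; intros p i.
    apply ren_ext_bound; intros k l; symmetry; apply Es.
    apply list_fv_bound_in in i; lia.
  - rewrite <- (ren_id q) at 1. apply ren_ext_bound; intros [|k] l; cbn.
    + unfold s; now rewrite Nat.eqb_refl.
    + rewrite Es; lia.
Qed.

Lemma exfalso T H p : proves T H fBot -> proves T H p.
Proof. intros D; apply Raa. eapply weakening; [exact D | apply incl_tl, incl_refl]. Qed.

(** * Tarski semantics and completeness *)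

Fixpoint sat {M : Type} (E : M -> M -> Prop) (rho : nat -> M) (p : form) : Prop :=
  match p with
  | fBot => False
  | fMem i j => E (rho i) (rho j)
  | fEq i j => rho i = rho j
  | fImp p q => sat E rho p -> sat E rho q
  | fAll p => forall a, sat E (a .: rho) p
  end.

Lemma sat_ren {M} (E : M -> M -> Prop) s p : forall rho,
  sat E rho (ren s p) <-> sat E (fun n => rho (s n)) p.
Proof.
  revert s; induction p as [|i j|i j|p IHp q IHq|p IHp]; intros s rho; cbn;
    try tauto.
  - rewrite IHp, IHq; tauto.
  - assert (up_scons : forall a, (fun n => (a .: rho) (up s n)) = a .: (fun n => rho (s n))).
    { intros a; apply functional_extensionality; intros [|n]; reflexivity. }
    split; intros H a; specialize (H a); revert H; rewrite IHp, up_scons; tauto.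
Qed.

Fixpoint code (p : form) : nat :=
  match p with
  | fBot => to_nat (0, 0)
  | fMem i j => to_nat (1, to_nat (i, j))
  | fEq i j => to_nat (2, to_nat (i, j))
  | fImp p q => to_nat (3, to_nat (code p, code q))
  | fAll p => to_nat (4, code p)
  end.

Lemma to_nat_eq a b c d : to_nat (a, b) = to_nat (c, d) -> a = c /\ b = d.
Proof.
  intros E. apply (f_equal of_nat) in E. rewrite !cancel_of_to in E.
  now injection E.
Qed.

Lemma code_inj p q : code p = code q -> p = q.
Proof.
  revert q; induction p as [|i j|i j|p IHp q IHq|p IHp]; intros [|i' j'|i' j'|p' q'|p'] E;
    apply to_nat_eq in E as [E1 E2]; try discriminate E1; try reflexivity;
    try (apply to_nat_eq in E2 as [E2 E3]).
  - now subst.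
  - now subst.
  - now rewrite (IHp _ E2), (IHq _ E3).
  - now rewrite (IHp _ E2).
Qed.

(** A surjection of the natural numbers onto the formulas, to run the Henkin
    construction through all of them. *)
Definition enum (n : nat) : form := epsilon (inhabits fBot) (fun p => code p = n).

Lemma enum_code p : enum (code p) = p.
Proof.
  apply code_inj, (epsilon_spec (inhabits fBot) (fun q => code q = code p)).
  now exists p.
Qed.

(** A Henkin construction in which free variables serve as the witnessing
    constants: the context stays finite, so there is always a fresh variable,
    and no renaming of the axioms is needed because they are provable under
    every renaming of their variables. *)
Section Henkin.

Variables (T : form -> Prop) (phi : form).
Hypothesis unprovable : ~ proves T [] phi.

Definition consistent (H : list form) : Prop := ~ proves T H fBot.

(** Adds [p] if this is consistent, and then, if [p] denies a universal
    statement, also a counterexample named by a fresh variable. *)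
Definition extend (H : list form) (p : form) : list form :=
  if excluded_middle_informative (consistent (p :: H)) then
    match p with
    | fImp (fAll q) fBot =>
        fImp (inst (list_fv_bound (p :: H)) q) fBot :: p :: H
    | _ => p :: H
    end
  else H.

Fixpoint stage (n : nat) : list form :=
  match n with
  | 0 => [fImp phi fBot]
  | S n => extend (stage n) (enum n)
  end.

Lemma extend_consistent H p : consistent H -> consistent (extend H p).
Proof.
  intros c. unfold extend; destruct excluded_middle_informative as [c'|]; [|assumption].
  destruct p as [| | |q r|]; try assumption.
  destruct q as [| | | |q]; try assumption.
  destruct r; try assumption.
  set (p := fImp (fAll q) fBot) in *.
  intros D. apply c'. apply ImpE with (fAll q); [apply Hyp; now left|].
  apply gen_fresh with (list_fv_bound (p :: H)); [lia | cbn; lia |].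
  apply Raa, D.
Qed.

Lemma stage_consistent n : consistent (stage n).
Proof.
  induction n as [|n IH]; cbn; [|now apply extend_consistent].
  intros D; apply unprovable, Raa, D.
Qed.

Lemma extend_incl H p : incl H (extend H p).
Proof.
  unfold extend; destruct excluded_middle_informative; [|apply incl_refl].
  destruct p as [| | |q r|]; try apply incl_tl, incl_refl.
  destruct q as [| | | |q]; try apply incl_tl, incl_refl.
  destruct r; try apply incl_tl, incl_refl.
  apply incl_tl, incl_tl, incl_refl.
Qed.

Lemma stage_incl m n : m <= n -> incl (stage m) (stage n).
Proof.
  induction 1 as [|n _ IH]; [apply incl_refl|].
  eapply incl_tran; [exact IH | apply extend_incl].
Qed.

(** The limit theory, defined by provability instead of membership so that it
    is deductively closed from the start. *)
Definition Th (p : form) : Prop := exists n, proves T (stage n) p.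

Lemma Th_two p q r :
  (forall H, proves T H p -> proves T H q -> proves T H r) -> Th p -> Th q -> Th r.
Proof.
  intros rule [m Dp] [n Dq]; exists (Nat.max m n); apply rule.
  - eapply weakening; [exact Dp | apply stage_incl; lia].
  - eapply weakening; [exact Dq | apply stage_incl; lia].
Qed.

Lemma Th_one p r : (forall H, proves T H p -> proves T H r) -> Th p -> Th r.
Proof. intros rule [m D]; exists m; now apply rule. Qed.

Lemma Th_consistent : ~ Th fBot.
Proof. intros [n D]; exact (stage_consistent n D). Qed.

Lemma Th_mp p q : Th (fImp p q) -> Th p -> Th q.
Proof. apply Th_two; intros H; apply ImpE. Qed.

Lemma stage_code p : stage (S (code p)) = extend (stage (code p)) p.
Proof. cbn; now rewrite enum_code. Qed.

Lemma Th_complete p : Th p \/ Th (fImp p fBot).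
Proof.
  destruct (classic (consistent (p :: stage (code p)))) as [c|c].
  - left; exists (S (code p)); apply Hyp; rewrite stage_code.
    unfold extend; destruct excluded_middle_informative; [|contradiction].
    destruct p as [| | |q r|]; try now left.
    destruct q as [| | | |q]; try now left.
    destruct r; try now left. right; now left.
  - right; exists (code p); apply ImpI. now apply NNPP.
Qed.

Lemma Th_imp p q : Th (fImp p q) <-> (Th p -> Th q).
Proof.
  split; [apply Th_mp|]. intros H.
  destruct (Th_complete p) as [Tp|Tp].
  - revert Tp; intros Tp%H; revert Tp; apply Th_one; intros H' D.
    apply ImpI. eapply weakening; [exact D | apply incl_tl, incl_refl].
  - revert Tp; apply Th_one; intros H' D. apply ImpI, exfalso.
    apply ImpE with p; [|apply Hyp; now left].
    eapply weakening; [exact D | apply incl_tl, incl_refl].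
Qed.

Lemma Th_all q : Th (fAll q) <-> forall k, Th (inst k q).
Proof.
  split; [intros H k; revert H; apply Th_one; intros H; apply Spec|].
  intros H. destruct (Th_complete (fAll q)) as [|N]; [assumption|exfalso].
  set (p := fImp (fAll q) fBot) in *.
  assert (c : consistent (p :: stage (code p))).
  { intros D%ImpI. apply Th_consistent. apply Th_mp with p; [|exact N].
    now exists (code p). }
  apply Th_consistent, (Th_mp (inst (list_fv_bound (p :: stage (code p))) q));
    [|apply H].
  exists (S (code p)); apply Hyp; rewrite stage_code.
  unfold extend; destruct excluded_middle_informative; [now left | contradiction].
Qed.

Lemma Th_refl i : Th (fEq i i).
Proof. exists 0; apply EqRefl. Qed.

Lemma Th_subst p i j s : Th (fEq i j) -> Th (ren (i .: s) p) -> Th (ren (j .: s) p).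
Proof. rewrite <- !inst_ren_up. apply Th_two; intros H. apply EqSubst. Qed.

Lemma Th_sym i j : Th (fEq i j) -> Th (fEq j i).
Proof.
  intros E. apply (Th_subst (fEq 0 1) i j (fun _ => i) E), Th_refl.
Qed.

Lemma Th_trans i j k : Th (fEq i j) -> Th (fEq j k) -> Th (fEq i k).
Proof. intros E F. now apply (Th_subst (fEq 1 0) j k (fun _ => i) F). Qed.

Lemma Th_mem_cong i j i' j' :
  Th (fEq i i') -> Th (fEq j j') -> Th (fMem i j) -> Th (fMem i' j').
Proof.
  intros E F D. apply (Th_subst (fMem 1 0) j j' (fun _ => i') F).
  now apply (Th_subst (fMem 0 1) i i' (fun _ => j) E).
Qed.

(** The domain: variables modulo provable equality, as equivalence classes, so
    that equality is interpreted by equality. *)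
Definition Dom : Type := {P : nat -> Prop | exists i, P = fun j => Th (fEq i j)}.

Definition cls (i : nat) : Dom := exist _ (fun j => Th (fEq i j)) (ex_intro _ i eq_refl).

Lemma cls_eq i j : cls i = cls j <-> Th (fEq i j).
Proof.
  split.
  - intros E. apply (f_equal (fun c => proj1_sig c j)) in E; cbn in E.
    rewrite E; apply Th_refl.
  - intros E. apply eq_sig_hprop; [intros; apply proof_irrelevance|]; cbn.
    apply functional_extensionality; intros k; apply propositional_extensionality.
    split; apply Th_trans; [now apply Th_sym | exact E].
Qed.

Lemma cls_surj (c : Dom) : exists i, c = cls i.
Proof.
  destruct c as [P [i ->]]; exists i.
  apply eq_sig_hprop; [intros; apply proof_irrelevance | reflexivity].
Qed.

Definition DomMem (a b : Dom) : Prop :=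
  exists i j, a = cls i /\ b = cls j /\ Th (fMem i j).

(** Every element of the domain is the class of a variable, so an assignment is
    a renaming [s], and truth under it is provability of the renamed formula. *)
Lemma truth p : forall s, sat DomMem (fun n => cls (s n)) p <-> Th (ren s p).
Proof.
  induction p as [|i j|i j|p IHp q IHq|p IHp]; intros s; cbn.
  - split; [tauto | apply Th_consistent].
  - split; [|intros D; now exists (s i), (s j)].
    intros (i' & j' & Ei & Ej & D).
    apply cls_eq, Th_sym in Ei; apply cls_eq, Th_sym in Ej.
    exact (Th_mem_cong _ _ _ _ Ei Ej D).
  - apply cls_eq.
  - rewrite Th_imp, IHp, IHq; tauto.
  - rewrite Th_all.
    assert (Es : forall k, cls k .: (fun n => cls (s n)) = fun n => cls ((k .: s) n)).
    { intros k; apply functional_extensionality; intros [|n]; reflexivity. }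
    split; intros H.
    + intros k. rewrite inst_ren_up, <- IHp, <- Es. apply H.
    + intros a. destruct (cls_surj a) as [k ->].
      rewrite Es, IHp, <- inst_ren_up. apply H.
Qed.

(** Satisfaction under an arbitrary assignment amounts to provability of all
    renamings of an axiom, which [ax_ren] provides. *)
Lemma Dom_model p : T p -> forall rho, sat DomMem rho p.
Proof.
  intros Tp rho.
  set (s := fun n => epsilon (inhabits 0) (fun i => rho n = cls i)).
  replace rho with (fun n => cls (s n)).
  - apply truth. exists 0. apply weakening with (H := []); [|apply incl_nil_l].
    now apply ax_ren, Ax.
  - apply functional_extensionality; intros n; symmetry.
    apply (epsilon_spec (inhabits 0) (fun i => rho n = cls i)), cls_surj.
Qed.

Lemma Dom_refutes : ~ sat DomMem cls phi.
Proof.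
  intros H. apply Th_consistent, (Th_mp phi).
  - exists 0; apply Hyp; now left.
  - rewrite <- (ren_id phi). apply truth, H.
Qed.

End Henkin.

(** Goedel's completeness theorem.  It turns the search for a formal
    derivation into ordinary reasoning inside an arbitrary model. *)
Theorem completeness T phi :
  (forall (M : Type) (E : M -> M -> Prop),
     (forall p, T p -> forall rho, sat E rho p) -> forall rho, sat E rho phi) ->
  proves T [] phi.
Proof.
  intros V. apply NNPP; intros N.
  apply (Dom_refutes T phi N). apply V, (Dom_model T phi N).
Qed.

Section Model.

Variables (M : Type) (E : M -> M -> Prop) (default : M).
Notation "x ∊ y" := (E x y) (at level 70).

(** * Reading formulas in the model *)

(** An [expr] at depth [d] is read under an assignment [rho] in which a variable
    of level [x] denotes [rho (idx d x)].  Each connective, although encoded by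
    implication and falsity, gets its native meaning classically. *)
Section Connectives.

Variables (rho : nat -> M) (d : nat).

Lemma sat_imp p q (A B : Prop) :
  (sat E rho (p d) <-> A) -> (sat E rho (q d) <-> B) ->
  (sat E rho (imp p q d) <-> (A -> B)).
Proof. cbn; tauto. Qed.

Lemma sat_neg p (A : Prop) :
  (sat E rho (p d) <-> A) -> (sat E rho (neg p d) <-> ~ A).
Proof. cbn; tauto. Qed.

Lemma sat_conj p q (A B : Prop) :
  (sat E rho (p d) <-> A) -> (sat E rho (q d) <-> B) ->
  (sat E rho (conj p q d) <-> A /\ B).
Proof. cbn; generalize (classic A), (classic B); tauto. Qed.

Lemma sat_disj p q (A B : Prop) :
  (sat E rho (p d) <-> A) -> (sat E rho (q d) <-> B) ->
  (sat E rho (disj p q d) <-> A \/ B).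
Proof. cbn; generalize (classic A), (classic B); tauto. Qed.

Lemma sat_iff p q (A B : Prop) :
  (sat E rho (p d) <-> A) -> (sat E rho (q d) <-> B) ->
  (sat E rho (iff p q d) <-> (A <-> B)).
Proof. cbn; generalize (classic A), (classic B); tauto. Qed.

Lemma sat_all P (A : M -> Prop) :
  (forall a, sat E (a .: rho) (P d (S d)) <-> A a) ->
  (sat E rho (all P d) <-> forall a, A a).
Proof. intros H; cbn; split; intros K a; apply H, K. Qed.

Lemma sat_ex P (A : M -> Prop) :
  (forall a, sat E (a .: rho) (P d (S d)) <-> A a) ->
  (sat E rho (ex P d) <-> exists a, A a).
Proof.
  intros H; cbn; split.
  - intros K; apply NNPP; intros N; apply K; intros a Pa.
    apply N; exists a; now apply H.
  - intros [a Aa] K; now apply (K a), H.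
Qed.

End Connectives.

Lemma sat_allin rho d S P (A : M -> Prop) :
  S < d -> (forall a, sat E (a .: rho) (P d (1 + d)) <-> A a) ->
  (sat E rho (allin S P d) <-> forall a, a ∊ rho (idx d S) -> A a).
Proof.
  intros l H. apply sat_all; intros a; apply sat_imp; [|apply H].
  cbn; unfold idx; rewrite Nat.sub_diag.
  now replace (d - S) with (1 + (d - (1 + S))) by lia.
Qed.

Lemma sat_exin rho d S P (A : M -> Prop) :
  S < d -> (forall a, sat E (a .: rho) (P d (1 + d)) <-> A a) ->
  (sat E rho (exin S P d) <-> exists a, a ∊ rho (idx d S) /\ A a).
Proof.
  intros l H. apply sat_ex; intros a; apply sat_conj; [|apply H].
  cbn; unfold idx; rewrite Nat.sub_diag.
  now replace (d - S) with (1 + (d - (1 + S))) by lia.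
Qed.

(** Translates a formula into a proposition about the model, one connective at
    a time; atomic formulas with concrete variable levels hold by computation. *)
Ltac translate_with leaf :=
  cbv beta;
  lazymatch goal with
  | |- sat _ _ (conj _ _ _) <-> _ => apply sat_conj; translate_with leaf
  | |- sat _ _ (disj _ _ _) <-> _ => apply sat_disj; translate_with leaf
  | |- sat _ _ (iff _ _ _) <-> _ => apply sat_iff; translate_with leaf
  | |- sat _ _ (neg _ _) <-> _ => apply sat_neg; translate_with leaf
  | |- sat _ _ (imp _ _ _) <-> _ => apply sat_imp; translate_with leaf
  | |- sat _ _ (all _ _) <-> _ => apply sat_all; intro; translate_with leaf
  | |- sat _ _ (ex _ _) <-> _ => apply sat_ex; intro; translate_with leaf
  | |- sat _ _ (allin _ _ _) <-> _ =>
      apply sat_allin; [repeat constructor | intro; translate_with leaf]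
  | |- sat _ _ (exin _ _ _) <-> _ =>
      apply sat_exin; [repeat constructor | intro; translate_with leaf]
  | |- sat _ _ (mem _ _ _) <-> _ => apply iff_refl
  | |- sat _ _ (eqv _ _ _) <-> _ => apply iff_refl
  | |- _ => leaf
  end.

Hypothesis M_ZF : forall p, ZF p -> forall rho, sat E rho p.

Lemma read_axiom rho p (A : Prop) :
  ZF (sentence p) -> (sat E rho (p 0) <-> A) -> A.
Proof. intros ax H. apply H, (M_ZF _ ax). Qed.

Lemma set_ext a b : (forall x, x ∊ a <-> x ∊ b) -> a = b.
Proof.
  revert a b. apply (read_axiom (fun _ => default) _ _ ZF_ext). unfold extensionality.
  translate_with idtac.
Qed.

Lemma pairing_ax a b : exists c, forall x, x ∊ c <-> x = a \/ x = b.
Proof.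
  revert a b. apply (read_axiom (fun _ => default) _ _ ZF_pair). unfold pairing. translate_with idtac.
Qed.

Lemma union_ax a : exists u, forall x, x ∊ u <-> exists y, y ∊ a /\ x ∊ y.
Proof.
  revert a. apply (read_axiom (fun _ => default) _ _ ZF_union). unfold union. translate_with idtac.
Qed.

Lemma power_ax a : exists u, forall x, x ∊ u <-> forall y, y ∊ x -> y ∊ a.
Proof.
  revert a. apply (read_axiom (fun _ => default) _ _ ZF_power). unfold powerset. translate_with idtac.
Qed.

Lemma separation_ax p rho a :
  exists b, forall x, x ∊ b <-> x ∊ a /\ sat E (x .: rho) p.
Proof.
  revert a. apply (read_axiom rho _ _ (ZF_sep p)). unfold separation.
  translate_with idtac.
  unfold app; rewrite sat_ren.
  replace (fun n : nat => _) with (a1 .: rho); [reflexivity|].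
  apply functional_extensionality; intros [|[|n]]; reflexivity.
Qed.

(** * Definable predicates *)

(** An assignment that carries both the variables [rho] and the parameters [c],
    interleaved by the pairing function so that each has infinitely many places. *)
Definition mix (rho c : nat -> M) (n : nat) : M :=
  match of_nat n with (0, k) => rho k | (S _, k) => c k end.

Definition var_ix (k : nat) : nat := to_nat (0, k).
Definition param_ix (k : nat) : nat := to_nat (1, k).

Arguments var_ix : simpl never.
Arguments param_ix : simpl never.

Lemma mix_var rho c k : mix rho c (var_ix k) = rho k.
Proof. unfold mix, var_ix; now rewrite cancel_of_to. Qed.

Lemma mix_param rho c k : mix rho c (param_ix k) = c k.
Proof. unfold mix, param_ix; now rewrite cancel_of_to. Qed.

Definition mix_ren (v w : nat -> nat) (n : nat) : nat :=
  match of_nat n with (0, k) => v k | (S _, k) => w k end.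

(** First-order definability with parameters.  Predicates on assignments,
    not on single elements, make the closure under quantifiers expressible. *)
Definition definable (P : (nat -> M) -> Prop) : Prop :=
  exists q c, forall rho, P rho <-> sat E (mix rho c) q.

(** Definability of the graph: variable 0 is the value, the others are the
    arguments. *)
Definition definable_fun (g : (nat -> M) -> M) : Prop :=
  definable (fun rho => rho 0 = g (fun n => rho (S n))).

Lemma sat_mix_ren rho c rho' v w q :
  (forall k, rho k = rho' (v k)) -> (forall k, c k = rho' (w k)) ->
  (sat E (mix rho c) q <-> sat E rho' (ren (mix_ren v w) q)).
Proof.
  intros Hv Hw. rewrite sat_ren.
  replace (mix rho c) with (fun n => rho' (mix_ren v w n)); [reflexivity|].
  apply functional_extensionality; intros n. unfold mix, mix_ren.
  now destruct (of_nat n) as [[|b] k].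
Qed.

Lemma def_ext P Q : (forall rho, P rho <-> Q rho) -> definable P -> definable Q.
Proof.
  intros H (q & c & K); exists q, c; intros rho. now rewrite <- H.
Qed.

Lemma def_rename P (s : nat -> nat) :
  definable P -> definable (fun rho => P (fun n => rho (s n))).
Proof.
  intros (q & c & H). exists (ren (mix_ren (fun k => var_ix (s k)) param_ix) q), c.
  intros rho. rewrite H. apply sat_mix_ren; intros k.
  - now rewrite mix_var.
  - now rewrite mix_param.
Qed.

Lemma def_false : definable (fun _ => False).
Proof. exists fBot, (fun _ => default). reflexivity. Qed.

Lemma def_imp P Q :
  definable P -> definable Q -> definable (fun rho => P rho -> Q rho).
Proof.
  intros (p & c & H) (q & c' & K).
  exists (fImp (ren (mix_ren var_ix (fun k => param_ix (var_ix k))) p)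
               (ren (mix_ren var_ix (fun k => param_ix (param_ix k))) q)), (mix c c').
  intros rho; cbn; rewrite H, K.
  rewrite <- (sat_mix_ren rho c), <- (sat_mix_ren rho c'); [tauto|..]; intros k;
    now rewrite ?mix_param, ?mix_var, ?mix_param.
Qed.

Lemma def_all (P : M -> (nat -> M) -> Prop) :
  definable (fun rho => P (rho 0) (fun n => rho (S n))) ->
  definable (fun rho => forall a, P a rho).
Proof.
  intros (q & c & H).
  exists (fAll (ren (mix_ren (0 .: fun k => S (var_ix k)) (fun k => S (param_ix k))) q)), c.
  intros rho; cbn.
  assert (K : forall a, P a rho <-> sat E (mix (a .: rho) c) q)
    by (intros a; rewrite <- H; reflexivity).
  split; intros L a; specialize (L a); revert L; rewrite K; apply sat_mix_ren;
    try (intros [|k]; cbn; now rewrite ?mix_var);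
    intros k; cbn; now rewrite mix_param.
Qed.

Lemma def_var_mem i j : definable (fun rho => rho i ∊ rho j).
Proof.
  exists (fMem (var_ix i) (var_ix j)), (fun _ => default).
  intros rho; cbn. now rewrite !mix_var.
Qed.

Lemma def_var_eq i j : definable (fun rho => rho i = rho j).
Proof.
  exists (fEq (var_ix i) (var_ix j)), (fun _ => default).
  intros rho; cbn. now rewrite !mix_var.
Qed.

Lemma def_not P : definable P -> definable (fun rho => ~ P rho).
Proof. intros H; apply def_imp; [exact H | apply def_false]. Qed.

Lemma def_or P Q : definable P -> definable Q -> definable (fun rho => P rho \/ Q rho).
Proof.
  intros H K. apply def_ext with (fun rho => ~ P rho -> Q rho).
  - intros rho; generalize (classic (P rho)); tauto.
  - apply def_imp; [apply def_not, H | exact K].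
Qed.

Lemma def_and P Q : definable P -> definable Q -> definable (fun rho => P rho /\ Q rho).
Proof.
  intros H K. apply def_ext with (fun rho => ~ (P rho -> ~ Q rho)).
  - intros rho; generalize (classic (P rho)), (classic (Q rho)); tauto.
  - apply def_not, def_imp; [exact H | apply def_not, K].
Qed.

Lemma def_iff P Q : definable P -> definable Q -> definable (fun rho => P rho <-> Q rho).
Proof. intros H K; apply def_and; now apply def_imp. Qed.

Lemma def_ex (P : M -> (nat -> M) -> Prop) :
  definable (fun rho => P (rho 0) (fun n => rho (S n))) ->
  definable (fun rho => exists a, P a rho).
Proof.
  intros H. apply def_ext with (fun rho => ~ forall a, ~ P a rho).
  - intros rho; split; [|intros [a Pa] N; exact (N a Pa)].
    intros N; apply NNPP; intros N'; apply N; intros a Pa; apply N'; now exists a.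
  - now apply def_not, (def_all (fun a rho => ~ P a rho)), def_not.
Qed.

(** A definable term [g rho] inside a formula is eliminated through
    [exists a, a = g rho /\ P a rho]. *)
Lemma def_subst g (P : M -> (nat -> M) -> Prop) :
  definable_fun g -> definable (fun rho => P (rho 0) (fun n => rho (S n))) ->
  definable (fun rho => P (g rho) rho).
Proof.
  intros H K. apply def_ext with (fun rho => exists a, a = g rho /\ P a rho).
  - intros rho; split; [intros (a & -> & L); exact L | intros L; now exists (g rho)].
  - apply (def_ex (fun a rho => a = g rho /\ P a rho)), def_and; assumption.
Qed.

Lemma def_fun_shift g : definable_fun g -> definable_fun (fun rho => g (fun n => rho (S n))).
Proof.
  intros H. apply (def_rename _ (0 .: fun n => S (S n)) H).
Qed.

Lemma def_rel (P : M -> M -> Prop) g h :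
  definable (fun rho => P (rho 0) (rho 1)) -> definable_fun g -> definable_fun h ->
  definable (fun rho => P (g rho) (h rho)).
Proof.
  intros HP Hg Hh. apply (def_subst g (fun a rho => P a (h rho)) Hg).
  apply (def_subst (fun rho => h (fun n => rho (S n))) (fun b rho => P (rho 0) b)).
  - now apply def_fun_shift.
  - exact (def_rename _ (1 .: fun _ => 0) HP).
Qed.

Lemma def_fun2 (F : M -> M -> M) g h :
  definable_fun (fun rho => F (rho 0) (rho 1)) -> definable_fun g -> definable_fun h ->
  definable_fun (fun rho => F (g rho) (h rho)).
Proof.
  intros HF Hg%def_fun_shift Hh%def_fun_shift.
  apply (def_subst _ (fun a rho => rho 0 = F a (h (fun n => rho (S n)))) Hg).
  apply (def_subst (fun rho => h (fun n => rho (S (S n)))) (fun b rho => rho 1 = F (rho 0) b)).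
  - exact (def_fun_shift _ Hh).
  - exact (def_rename _ (2 .: 1 .: fun _ => 0) HF).
Qed.

Lemma def_mem g h :
  definable_fun g -> definable_fun h -> definable (fun rho => g rho ∊ h rho).
Proof. apply (def_rel E), def_var_mem. Qed.

Lemma def_eq g h :
  definable_fun g -> definable_fun h -> definable (fun rho => g rho = h rho).
Proof. apply (def_rel eq), def_var_eq. Qed.

Lemma def_var i : definable_fun (fun rho => rho i).
Proof. apply (def_var_eq 0 (S i)). Qed.

Lemma def_param a : definable_fun (fun _ => a).
Proof.
  exists (fEq (var_ix 0) (param_ix 0)), (fun _ => a).
  intros rho; cbn. now rewrite mix_var, mix_param.
Qed.

(** * Definite descriptions and class terms *)

Definition is_iota (P : M -> Prop) (y : M) : Prop :=
  P y /\ (forall z, P z -> z = y)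
  \/ ~ (exists y, P y /\ forall z, P z -> z = y) /\ y = default.

(** A total description operator: in the absence of a unique solution it takes the
    fixed value [default], which keeps its graph first-order definable. *)
Definition iota (P : M -> Prop) : M := epsilon (inhabits default) (is_iota P).

Lemma iota_spec P : is_iota P (iota P).
Proof.
  apply (epsilon_spec (inhabits default) (is_iota P)).
  destruct (classic (exists y, P y /\ forall z, P z -> z = y)) as [[y H]|N].
  - exists y; now left.
  - exists default; now right.
Qed.

Lemma is_iota_unique P y z : is_iota P y -> is_iota P z -> y = z.
Proof.
  intros [[Py U]|[N ->]] [[Pz V]|[N' ->]].
  - now apply V.
  - exfalso; apply N'; now exists y.
  - exfalso; apply N; now exists z.
  - reflexivity.
Qed.

Lemma iota_eq (P : M -> Prop) y : P y -> (forall z, P z -> z = y) -> iota P = y.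
Proof.
  intros Py U. apply (is_iota_unique P); [apply iota_spec | now left].
Qed.

Lemma def_iota (P : M -> (nat -> M) -> Prop) :
  definable (fun rho => P (rho 0) (fun n => rho (S n))) ->
  definable_fun (fun rho => iota (fun y => P y rho)).
Proof.
  intros H.
  apply def_ext with (fun rho => is_iota (fun y => P y (fun n => rho (S n))) (rho 0)).
  - intros rho; split; [|intros ->; apply iota_spec].
    intros K; exact (is_iota_unique _ _ _ K (iota_spec _)).
  - assert (D : forall i, definable (fun rho =>
      P (rho i) (fun n => rho (S (S n))) /\
      forall z, P z (fun n => rho (S (S n))) -> z = rho i)).
    { intros i. apply def_and.
      - apply (def_rename _ (i .: fun n => S (S n)) H).
      - apply (def_all (fun z rho => P z (fun n => rho (S (S n))) -> z = rho i)).
        apply def_imp; [|apply def_var_eq].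
        apply (def_rename _ (0 .: fun n => S (S (S n))) H). }
    apply def_or.
    + apply (def_rename _ (fun n => match n with 0 => 0 | S n => n end) (D 0)).
    + apply def_and; [|apply def_eq; [apply def_var | apply def_param]].
      apply def_not.
      apply (def_ex (fun y rho => P y (fun n => rho (S n)) /\
        forall z, P z (fun n => rho (S n)) -> z = y)), D.
Qed.

Definition class (P : M -> Prop) : M := iota (fun b => forall x, x ∊ b <-> P x).

Lemma in_class P x : (exists b, forall x, x ∊ b <-> P x) -> (x ∊ class P <-> P x).
Proof.
  intros [b H]. unfold class. rewrite (iota_eq _ b); [apply H | exact H |].
  intros c K. apply set_ext; intros y. now rewrite H, K.
Qed.

Lemma def_class (P : M -> (nat -> M) -> Prop) :
  definable (fun rho => P (rho 0) (fun n => rho (S n))) ->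
  definable_fun (fun rho => class (fun x => P x rho)).
Proof.
  intros H. apply (def_iota (fun b rho => forall x, x ∊ b <-> P x rho)).
  apply (def_all (fun x rho => x ∊ rho 0 <-> P x (fun n => rho (S n)))).
  apply def_iff; [apply def_var_mem|].
  apply (def_rename _ (0 .: fun n => S (S n)) H).
Qed.

Lemma separation (P : M -> Prop) a :
  definable (fun rho => P (rho 0)) ->
  exists b, forall x, x ∊ b <-> x ∊ a /\ P x.
Proof.
  intros (q & c & H).
  destruct (separation_ax (ren (mix_ren (0 .: fun _ => 1) (fun k => S k)) q) c a) as [b K].
  exists b; intros x. rewrite K.
  rewrite (H (x .: fun _ => c 0)). rewrite <- (sat_mix_ren (x .: fun _ => c 0) c);
    [reflexivity|..].
  - intros [|k]; reflexivity.
  - reflexivity.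
Qed.

(** The working form of separation: a definable predicate bounded by a set has
    an extension. *)
Lemma in_class_sub (P : M -> Prop) a x :
  definable (fun rho => P (rho 0)) -> (forall x, P x -> x ∊ a) -> (x ∊ class P <-> P x).
Proof.
  intros D B. apply in_class. destruct (separation P a D) as [b H].
  exists b; intros y. rewrite H. specialize (B y); tauto.
Qed.

(** * Elementary set theory in the model *)

Definition upair a b : M := class (fun x => x = a \/ x = b).
Definition pair a b : M := class (fun z => z = upair a a \/ z = upair a b).
Definition bigunion a : M := class (fun x => exists y, y ∊ a /\ x ∊ y).
Definition power a : M := class (fun x => forall y, y ∊ x -> y ∊ a).

Lemma in_upair a b x : x ∊ upair a b <-> x = a \/ x = b.
Proof. apply (in_class (fun x => x = a \/ x = b)), pairing_ax. Qed.

Lemma in_pair a b x : x ∊ pair a b <-> x = upair a a \/ x = upair a b.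
Proof. apply (in_class (fun x => x = upair a a \/ x = upair a b)), pairing_ax. Qed.

Lemma in_bigunion a x : x ∊ bigunion a <-> exists y, y ∊ a /\ x ∊ y.
Proof. apply (in_class (fun x => exists y, y ∊ a /\ x ∊ y)), union_ax. Qed.

Lemma in_power a x : x ∊ power a <-> forall y, y ∊ x -> y ∊ a.
Proof. apply (in_class (fun x => forall y, y ∊ x -> y ∊ a)), power_ax. Qed.

Lemma upair_inj a b c d :
  upair a b = upair c d -> a = c /\ b = d \/ a = d /\ b = c.
Proof.
  intros H.
  assert (K : forall x, x = a \/ x = b <-> x = c \/ x = d)
    by (intros x; rewrite <- !in_upair; now rewrite H).
  destruct (proj1 (K a)), (proj1 (K b)), (proj2 (K c)), (proj2 (K d));
    subst; auto.
Qed.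

Lemma pair_inj a b c d : pair a b = pair c d -> a = c /\ b = d.
Proof.
  intros H.
  destruct (upair_inj _ _ _ _ H) as [[H1 H2]|[H1 H2]];
    apply upair_inj in H1; apply upair_inj in H2;
    destruct H1 as [[]|[]], H2 as [[]|[]]; subst; auto.
Qed.

Ltac inj H := apply pair_inj in H; destruct H as [? ?].

Lemma def_upair g h :
  definable_fun g -> definable_fun h -> definable_fun (fun rho => upair (g rho) (h rho)).
Proof.
  apply (def_fun2 upair), (def_class (fun x rho => x = rho 0 \/ x = rho 1)).
  apply def_or; apply def_var_eq.
Qed.

Lemma def_pair g h :
  definable_fun g -> definable_fun h -> definable_fun (fun rho => pair (g rho) (h rho)).
Proof.
  apply (def_fun2 pair), (def_class
    (fun x rho => x = upair (rho 0) (rho 0) \/ x = upair (rho 0) (rho 1))).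
  apply def_or; apply def_eq; try apply def_var; apply def_upair; apply def_var.
Qed.

(** Decomposes the goal by its outermost connective or term former.  Defined
    predicates have to be unfolded beforehand. *)
Ltac definability_step :=
  cbv beta;
  lazymatch goal with
  | |- definable (fun rho => @?P rho /\ @?Q rho) => apply (def_and P Q)
  | |- definable (fun rho => @?P rho \/ @?Q rho) => apply (def_or P Q)
  | |- definable (fun rho => @?P rho <-> @?Q rho) => apply (def_iff P Q)
  | |- definable (fun rho => ~ @?P rho) => apply (def_not P)
  | |- definable (fun rho => @?P rho -> @?Q rho) => apply (def_imp P Q)
  | |- definable (fun rho => forall a : M, @?P rho a) =>
      apply (def_all (fun a rho => P rho a))
  | |- definable (fun rho => exists a : M, @?P rho a) =>
      apply (def_ex (fun a rho => P rho a))
  | |- definable (fun rho => E (@?g rho) (@?h rho)) => apply (def_mem g h)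
  | |- definable (fun rho => @?g rho = @?h rho) => apply (def_eq g h)
  | |- definable_fun (fun rho => pair (@?g rho) (@?h rho)) => apply (def_pair g h)
  | |- definable_fun (fun rho => class (@?P rho)) => apply (def_class (fun a rho => P rho a))
  | |- definable_fun (fun rho => iota (@?P rho)) => apply (def_iota (fun a rho => P rho a))
  | |- definable_fun (fun rho => rho ?i) => apply (def_var i)
  | |- definable_fun (fun _ => ?a) => apply (def_param a)
  end.


Ltac definability := repeat definability_step.

Definition prod A B : M := class (fun p => exists x, x ∊ A /\ exists y, y ∊ B /\ p = pair x y).

Lemma in_prod A B p :
  p ∊ prod A B <-> exists x, x ∊ A /\ exists y, y ∊ B /\ p = pair x y.
Proof.
  apply (in_class_sub (fun p => exists x, x ∊ A /\ exists y, y ∊ B /\ p = pair x y)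
    (power (power (bigunion (upair A B))))); [definability|].
  intros q (x & Hx & y & Hy & ->).
  assert (U : x ∊ bigunion (upair A B) /\ y ∊ bigunion (upair A B)).
  { rewrite !in_bigunion; split; [exists A | exists B]; rewrite in_upair; tauto. }
  apply in_power; intros z [->| ->]%in_pair; apply in_power;
    intros w [->| ->]%in_upair; tauto.
Qed.

Lemma pair_in_prod A B x y : pair x y ∊ prod A B <-> x ∊ A /\ y ∊ B.
Proof.
  rewrite in_prod; split.
  - intros (x' & Hx & y' & Hy & H); inj H; now subst.
  - intros [Hx Hy]; eauto 6.
Qed.

(** * Reading the definitions in the model *)

(** Each predicate is the meaning of the formula of the same name, with ordered
    pairs turned into the terms [pair x y]; [translate] proves the agreement in
    [read_urysohn]. *)

Definition Subset A B := forall x, x ∊ A -> x ∊ B.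
Definition Disjoint A B := ~ exists x, x ∊ A /\ x ∊ B.
Definition Is_empty A := forall x, ~ x ∊ A.
Definition Is_singleton A x := forall z, z ∊ A <-> z = x.
Definition Is_bigunion U S := forall x, x ∊ U <-> exists A, A ∊ S /\ x ∊ A.
Definition Is_diff C A B := forall x, x ∊ C <-> x ∊ A /\ ~ x ∊ B.
Definition Is_prod P A B :=
  forall p, p ∊ P <-> exists x, x ∊ A /\ exists y, y ∊ B /\ p = pair x y.
Definition Is_function f A B :=
  (forall p, p ∊ f -> exists x, x ∊ A /\ exists y, y ∊ B /\ p = pair x y) /\
  forall x, x ∊ A -> exists y, y ∊ B /\ pair x y ∊ f /\ forall z, pair x z ∊ f -> z = y.
Definition Is_preimage W f X V :=
  forall x, x ∊ W <-> x ∊ X /\ exists y, y ∊ V /\ pair x y ∊ f.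

Definition Op f x y z := pair (pair x y) z ∊ f.
Definition Is_binop f R := exists P, Is_prod P R R /\ Is_function f P R.
Definition Is_comm_monoid R f e :=
  Is_binop f R /\ e ∊ R
  /\ (forall x, x ∊ R -> Op f x e x)
  /\ (forall x, x ∊ R -> forall y, y ∊ R -> forall z, z ∊ R -> Op f x y z -> Op f y x z)
  /\ (forall x, x ∊ R -> forall y, y ∊ R -> forall z, z ∊ R ->
      forall u, u ∊ R -> forall v, v ∊ R -> forall w, w ∊ R ->
      Op f x y u -> Op f y z v -> Op f u z w -> Op f x v w).
Definition Is_field R zero one add mul :=
  Is_comm_monoid R add zero /\ Is_comm_monoid R mul one
  /\ ~ zero = one
  /\ (forall x, x ∊ R -> exists y, y ∊ R /\ Op add x y zero)
  /\ (forall x, x ∊ R -> ~ x = zero -> exists y, y ∊ R /\ Op mul x y one)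
  /\ (forall x, x ∊ R -> forall y, y ∊ R -> forall z, z ∊ R -> forall s, s ∊ R ->
      forall u, u ∊ R -> forall v, v ∊ R -> forall w, w ∊ R ->
      Op add y z s -> Op mul x y u -> Op mul x z v -> Op mul x s w -> Op add u v w).
Definition Is_linear_order R lt :=
  (forall x, x ∊ R -> ~ pair x x ∊ lt)
  /\ (forall x, x ∊ R -> forall y, y ∊ R -> forall z, z ∊ R ->
      pair x y ∊ lt -> pair y z ∊ lt -> pair x z ∊ lt)
  /\ (forall x, x ∊ R -> forall y, y ∊ R -> pair x y ∊ lt \/ x = y \/ pair y x ∊ lt).
Definition Le lt x y := pair x y ∊ lt \/ x = y.
Definition Upper_bound lt S b := forall x, x ∊ S -> Le lt x b.
Definition Is_complete_order R lt :=
  forall S, Subset S R -> ~ Is_empty S -> (exists b, b ∊ R /\ Upper_bound lt S b) ->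
  exists s, s ∊ R /\ Upper_bound lt S s /\
    forall b, b ∊ R -> Upper_bound lt S b -> Le lt s b.
Definition Is_real_line R zero one add mul lt :=
  Is_field R zero one add mul /\ Is_linear_order R lt
  /\ (forall x, x ∊ R -> forall y, y ∊ R -> forall z, z ∊ R ->
      forall u, u ∊ R -> forall v, v ∊ R ->
      pair x y ∊ lt -> Op add x z u -> Op add y z v -> pair u v ∊ lt)
  /\ (forall x, x ∊ R -> forall y, y ∊ R -> forall z, z ∊ R ->
      pair zero x ∊ lt -> pair zero y ∊ lt -> Op mul x y z -> pair zero z ∊ lt)
  /\ Is_complete_order R lt.

Definition Is_gentop X mu :=
  (forall U, U ∊ mu -> Subset U X) /\
  forall S, Subset S mu -> exists U, U ∊ mu /\ Is_bigunion U S.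
Definition Closed_in X mu A := Subset A X /\ exists U, U ∊ mu /\ Is_diff U X A.
Definition Continuous f X muX Y muY :=
  Is_function f X Y /\ forall V, V ∊ muY -> exists W, W ∊ muX /\ Is_preimage W f X V.
Definition Is_closed_pairs P X mu :=
  forall p, p ∊ P <-> exists A B, p = pair A B /\
    Closed_in X mu A /\ Closed_in X mu B /\ Disjoint A B.
Definition Is_open_pairs O mu :=
  forall p, p ∊ O <-> exists U V, p = pair U V /\ U ∊ mu /\ V ∊ mu /\ Disjoint U V.
Definition Effectively_normal X mu :=
  exists P O F, Is_closed_pairs P X mu /\ Is_open_pairs O mu /\ Is_function F P O /\
    forall p, p ∊ P -> forall q, pair p q ∊ F ->
    forall A B U V, p = pair A B -> q = pair U V -> Subset A U /\ Subset B V.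
Definition Is_left_ray R lt G a := forall x, x ∊ G <-> x ∊ R /\ pair x a ∊ lt.
Definition Is_right_ray R lt G a := forall x, x ∊ G <-> x ∊ R /\ pair a x ∊ lt.
Definition Is_two_rays R lt G a b :=
  forall x, x ∊ G <-> x ∊ R /\ (pair x a ∊ lt \/ pair b x ∊ lt).
Definition Is_gtau_n R lt T :=
  forall G, G ∊ T <->
    Is_empty G \/ G = R
    \/ (exists a, a ∊ R /\ Is_left_ray R lt G a)
    \/ (exists a, a ∊ R /\ Is_right_ray R lt G a)
    \/ (exists a, a ∊ R /\ exists b, b ∊ R /\ Le lt a b /\ Is_two_rays R lt G a b).
Definition Sub_fiber A f X r :=
  exists s W, Is_singleton s r /\ Is_preimage W f X s /\ Subset A W.
Definition Gul X mu R zero one T :=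
  forall A B, Closed_in X mu A -> Closed_in X mu B -> Disjoint A B ->
  exists f, Continuous f X mu R T /\ Sub_fiber A f X zero /\ Sub_fiber B f X one.

Lemma idx_older d x : x < d -> idx (S d) x = S (idx d x).
Proof. unfold idx; lia. Qed.

Lemma idx_newest d : idx (S d) d = 0.
Proof. unfold idx; lia. Qed.

(** The defining condition of the formula [is_opair], which mentions the
    components {x} and {x, y} only through their elements. *)
Lemma pair_char p x y :
  p = pair x y <->
  forall z, z ∊ p <-> (forall w, w ∊ z <-> w = x) \/ (forall w, w ∊ z <-> w = x \/ w = y).
Proof.
  assert (K : forall z, z ∊ pair x y <->
      (forall w, w ∊ z <-> w = x) \/ (forall w, w ∊ z <-> w = x \/ w = y)).
  { intros z. rewrite in_pair. split.
    - intros [->| ->]; [left|right]; intros w; rewrite in_upair; tauto.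
    - intros [H|H]; [left|right]; apply set_ext; intros w; rewrite H, in_upair; tauto. }
  split; [now intros -> | intros H; apply set_ext; intros z; now rewrite H, K].
Qed.

Lemma sat_is_opair rho d p x y : p < d -> x < d -> y < d ->
  (sat E rho (is_opair p x y d) <-> rho (idx d p) = pair (rho (idx d x)) (rho (idx d y))).
Proof.
  intros lp lx ly. rewrite pair_char. unfold is_opair, is_singleton, is_upair.
  apply sat_all; intros z; apply sat_iff; [|apply sat_disj; apply sat_all; intros w;
    apply sat_iff; [| |  |apply sat_disj]];
    unfold mem, eqv; cbn [sat]; rewrite ?idx_newest, !idx_older, ?idx_newest by lia;
    reflexivity.
Qed.

Lemma sat_opair_in rho d x y f : x < d -> y < d -> f < d ->
  (sat E rho (opair_in x y f d) <-> pair (rho (idx d x)) (rho (idx d y)) ∊ rho (idx d f)).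
Proof.
  intros lx ly lf.
  transitivity (exists p, p ∊ rho (idx d f) /\ p = pair (rho (idx d x)) (rho (idx d y))).
  - apply sat_exin; [exact lf|]; intros p. cbn [Nat.add].
    rewrite sat_is_opair by lia. rewrite idx_newest, !idx_older by lia. reflexivity.
  - split; [intros (p & Hp & ->); exact Hp | eauto].
Qed.

Lemma sat_op rho d f x y z : f < d -> x < d -> y < d -> z < d ->
  (sat E rho (op f x y z d) <->
   Op (rho (idx d f)) (rho (idx d x)) (rho (idx d y)) (rho (idx d z))).
Proof.
  intros lf lx ly lz. unfold Op.
  transitivity (exists p, p = pair (rho (idx d x)) (rho (idx d y)) /\
    pair p (rho (idx d z)) ∊ rho (idx d f)).
  - apply sat_ex; intros p; apply sat_conj.
    + rewrite sat_is_opair by lia. rewrite idx_newest, !idx_older by lia. reflexivity.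
    + rewrite sat_opair_in by lia. rewrite idx_newest, !idx_older by lia. reflexivity.
  - split; [intros (p & -> & H); exact H | eauto].
Qed.

Ltac head t := lazymatch t with ?f _ => head f | _ => t end.

(** Ordered pairs are read as terms; every other definition is unfolded.  The
    leading [idtac] delays the match until the leaf is reached. *)
Ltac translate := translate_with ltac:(idtac;
  lazymatch goal with
  | |- sat _ _ (is_opair _ _ _ _) <-> _ => apply sat_is_opair; repeat constructor
  | |- sat _ _ (opair_in _ _ _ _) <-> _ => apply sat_opair_in; repeat constructor
  | |- sat _ _ (op _ _ _ _ _) <-> _ => apply sat_op; repeat constructor
  | |- sat _ _ ?e <-> _ => let h := head e in unfold h; translate
  end).

Lemma read_urysohn rho :
  sat E rho ((∀ R zero one add mul lt T,
       is_real_line R zero one add mul lt ⟶ is_gtau_n R lt T ⟶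
       ∀ X mu, is_gentop X mu ⟶ effectively_normal X mu ⟶
         GUL X mu R zero one T) 0) <->
  forall R zero one add mul lt T,
    Is_real_line R zero one add mul lt -> Is_gtau_n R lt T ->
    forall X mu, Is_gentop X mu -> Effectively_normal X mu -> Gul X mu R zero one T.
Proof. translate. Qed.

(** * Arithmetic of the real line *)

Section Operation.

Variables (R f e : M).
Hypothesis monoid : Is_comm_monoid R f e.

Definition ap (f x y : M) : M := iota (fun z => Op f x y z).

Lemma op_ap x y : x ∊ R -> y ∊ R ->
  ap f x y ∊ R /\ forall z, Op f x y z <-> z = ap f x y.
Proof.
  intros Hx Hy. destruct monoid as [(P & HP & _ & HF) _].
  destruct (HF (pair x y)) as (z & Hz & Oz & U); [apply HP; eauto 6|].
  assert (Ez : ap f x y = z) by now apply iota_eq.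
  rewrite Ez; split; [exact Hz|]. intros w; split; [apply U | intros ->; exact Oz].
Qed.

Lemma ap_in x y : x ∊ R -> y ∊ R -> ap f x y ∊ R.
Proof. intros; now apply op_ap. Qed.

Lemma op_iff x y z : x ∊ R -> y ∊ R -> Op f x y z <-> z = ap f x y.
Proof. intros; now apply op_ap. Qed.

Lemma unit_in : e ∊ R.
Proof. destruct monoid as (_ & H & _); exact H. Qed.

Lemma ap_unit x : x ∊ R -> ap f x e = x.
Proof.
  intros Hx. symmetry. apply op_iff; [exact Hx | apply unit_in |].
  destruct monoid as (_ & _ & U & _). now apply U.
Qed.

Lemma ap_comm x y : x ∊ R -> y ∊ R -> ap f x y = ap f y x.
Proof.
  intros Hx Hy. apply op_iff; [exact Hy | exact Hx |].
  destruct monoid as (_ & _ & _ & C & _).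
  apply C; auto using ap_in. now apply op_iff.
Qed.

Lemma ap_assoc x y z : x ∊ R -> y ∊ R -> z ∊ R -> ap f (ap f x y) z = ap f x (ap f y z).
Proof.
  intros Hx Hy Hz. apply op_iff; [auto using ap_in..|].
  destruct monoid as (_ & _ & _ & _ & A).
  apply A with (y := y) (z := z) (u := ap f x y); auto using ap_in; now apply op_iff; auto using ap_in.
Qed.

Lemma ap_swap x y z w : x ∊ R -> y ∊ R -> z ∊ R -> w ∊ R ->
  ap f (ap f x y) (ap f z w) = ap f (ap f x z) (ap f y w).
Proof.
  intros Hx Hy Hz Hw.
  rewrite !ap_assoc, <- (ap_assoc y z w), (ap_comm y z), ap_assoc; auto using ap_in.
Qed.

End Operation.

Section RealLine.

Variables (R zero one add mul lt : M).
Hypothesis real_line : Is_real_line R zero one add mul lt.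

Notation "x + y" := (ap add x y).
Notation "x * y" := (ap mul x y).
Notation "x < y" := (pair x y ∊ lt).
Notation "x <= y" := (Le lt x y).

Lemma add_monoid : Is_comm_monoid R add zero.
Proof. apply real_line. Qed.
Lemma mul_monoid : Is_comm_monoid R mul one.
Proof. apply (proj1 real_line). Qed.

Lemma zero_in : zero ∊ R.
Proof. exact (unit_in _ _ _ add_monoid). Qed.
Lemma one_in : one ∊ R.
Proof. exact (unit_in _ _ _ mul_monoid). Qed.
Lemma add_in x y : x ∊ R -> y ∊ R -> x + y ∊ R.
Proof. exact (ap_in _ _ _ add_monoid x y). Qed.
Lemma mul_in x y : x ∊ R -> y ∊ R -> x * y ∊ R.
Proof. exact (ap_in _ _ _ mul_monoid x y). Qed.

Hint Resolve zero_in one_in add_in mul_in : reals.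
Ltac inR := auto with reals.

Lemma add_op x y z : x ∊ R -> y ∊ R -> Op add x y z <-> z = x + y.
Proof. exact (op_iff _ _ _ add_monoid x y z). Qed.
Lemma mul_op x y z : x ∊ R -> y ∊ R -> Op mul x y z <-> z = x * y.
Proof. exact (op_iff _ _ _ mul_monoid x y z). Qed.
Lemma add_0 x : x ∊ R -> x + zero = x.
Proof. exact (ap_unit _ _ _ add_monoid x). Qed.
Lemma mul_1 x : x ∊ R -> x * one = x.
Proof. exact (ap_unit _ _ _ mul_monoid x). Qed.
Lemma add_comm x y : x ∊ R -> y ∊ R -> x + y = y + x.
Proof. exact (ap_comm _ _ _ add_monoid x y). Qed.
Lemma mul_comm x y : x ∊ R -> y ∊ R -> x * y = y * x.
Proof. exact (ap_comm _ _ _ mul_monoid x y). Qed.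
Lemma add_assoc x y z : x ∊ R -> y ∊ R -> z ∊ R -> (x + y) + z = x + (y + z).
Proof. exact (ap_assoc _ _ _ add_monoid x y z). Qed.
Lemma add_swap x y z w : x ∊ R -> y ∊ R -> z ∊ R -> w ∊ R ->
  (x + y) + (z + w) = (x + z) + (y + w).
Proof. exact (ap_swap _ _ _ add_monoid x y z w). Qed.

Lemma zero_neq_one : zero <> one.
Proof. destruct real_line as [(_ & _ & H & _) _]; exact H. Qed.

Lemma opp_ex x : x ∊ R -> exists y, y ∊ R /\ x + y = zero.
Proof.
  intros Hx. destruct real_line as [(_ & _ & _ & N & _) _].
  destruct (N x Hx) as (y & Hy & Oy). exists y; split; [exact Hy|].
  symmetry; now apply add_op.
Qed.

Lemma inv_ex x : x ∊ R -> x <> zero -> exists y, y ∊ R /\ x * y = one.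
Proof.
  intros Hx nx. destruct real_line as [(_ & _ & _ & _ & N & _) _].
  destruct (N x Hx nx) as (y & Hy & Oy). exists y; split; [exact Hy|].
  symmetry; now apply mul_op.
Qed.

Lemma mul_add x y z : x ∊ R -> y ∊ R -> z ∊ R -> x * (y + z) = x * y + x * z.
Proof.
  intros Hx Hy Hz. destruct real_line as [(_ & _ & _ & _ & _ & D) _].
  apply add_op; inR.
  apply (D x Hx y Hy z Hz (y + z)); inR; (apply add_op || apply mul_op); inR.
Qed.

Lemma add_cancel x y z : x ∊ R -> y ∊ R -> z ∊ R -> x + z = y + z -> x = y.
Proof.
  intros Hx Hy Hz H. destruct (opp_ex z Hz) as (n & Hn & En).
  rewrite <- (add_0 x), <- (add_0 y), <- En, <- !add_assoc, H by inR. reflexivity.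
Qed.

Lemma sub_ex x y : x ∊ R -> y ∊ R -> exists z, z ∊ R /\ x + z = y.
Proof.
  intros Hx Hy. destruct (opp_ex x Hx) as (n & Hn & En). exists (n + y); split; inR.
  rewrite <- add_assoc, En, add_comm, add_0; inR.
Qed.

Lemma lt_irrefl x : x ∊ R -> ~ x < x.
Proof. destruct real_line as (_ & (H & _) & _). apply H. Qed.

Lemma lt_trans x y z : x ∊ R -> y ∊ R -> z ∊ R -> x < y -> y < z -> x < z.
Proof. destruct real_line as (_ & (_ & H & _) & _). intros; now apply H with y. Qed.

Lemma lt_total x y : x ∊ R -> y ∊ R -> x < y \/ x = y \/ y < x.
Proof. destruct real_line as (_ & (_ & _ & H) & _). intros; now apply H. Qed.

Lemma lt_add x y z : x ∊ R -> y ∊ R -> z ∊ R -> x < y -> x + z < y + z.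
Proof.
  intros Hx Hy Hz H. destruct real_line as (_ & _ & A & _).
  apply (A x Hx y Hy z Hz); inR; apply add_op; inR.
Qed.

Lemma mul_pos x y : x ∊ R -> y ∊ R -> zero < x -> zero < y -> zero < x * y.
Proof.
  intros Hx Hy px py. destruct real_line as (_ & _ & _ & A & _).
  apply (A x Hx y Hy); inR; apply mul_op; inR.
Qed.

Lemma le_trans x y z : x ∊ R -> y ∊ R -> z ∊ R -> x <= y -> y <= z -> x <= z.
Proof.
  intros Hx Hy Hz [H| ->] [K| ->]; unfold Le; auto. left; now apply lt_trans with y.
Qed.

Lemma lt_le_trans x y z : x ∊ R -> y ∊ R -> z ∊ R -> x < y -> y <= z -> x < z.
Proof. intros Hx Hy Hz H [K| <-]; [now apply lt_trans with y | exact H]. Qed.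

Lemma le_lt_trans x y z : x ∊ R -> y ∊ R -> z ∊ R -> x <= y -> y < z -> x < z.
Proof. intros Hx Hy Hz [K| ->] H; [now apply lt_trans with y | exact H]. Qed.

Lemma lt_or_le x y : x ∊ R -> y ∊ R -> x < y \/ y <= x.
Proof. intros Hx Hy. destruct (lt_total x y) as [|[->|]]; unfold Le; auto. Qed.

Lemma le_not_lt x y : x ∊ R -> y ∊ R -> x <= y -> ~ y < x.
Proof. intros Hx Hy H K. apply (lt_irrefl x Hx). now apply le_lt_trans with y. Qed.

Lemma le_antisym x y : x ∊ R -> y ∊ R -> x <= y -> y <= x -> x = y.
Proof.
  intros Hx Hy [H| ->] K; [|reflexivity]. now apply le_not_lt in K.
Qed.

Lemma le_add x y z : x ∊ R -> y ∊ R -> z ∊ R -> x <= y -> x + z <= y + z.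
Proof. intros Hx Hy Hz [H| ->]; [left; now apply lt_add | now right]. Qed.

Lemma le_add_inv x y z : x ∊ R -> y ∊ R -> z ∊ R -> x + z <= y + z -> x <= y.
Proof.
  intros Hx Hy Hz H. destruct (lt_or_le y x) as [K|K]; inR.
  apply (lt_add _ _ z) in K; inR. apply le_not_lt in H; inR. contradiction.
Qed.

Lemma le_add2 x y z w : x ∊ R -> y ∊ R -> z ∊ R -> w ∊ R ->
  x <= y -> z <= w -> x + z <= y + w.
Proof.
  intros Hx Hy Hz Hw H K. apply le_trans with (y + z); inR; [now apply le_add|].
  rewrite !(add_comm y) by inR. now apply le_add.
Qed.

Lemma lt_add2 x y z w : x ∊ R -> y ∊ R -> z ∊ R -> w ∊ R ->
  x < y -> z <= w -> x + z < y + w.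
Proof.
  intros Hx Hy Hz Hw H K. apply lt_le_trans with (y + z); inR; [now apply lt_add|].
  rewrite !(add_comm y) by inR. now apply le_add.
Qed.

Lemma lt_add_pos x y : x ∊ R -> y ∊ R -> x < x + y <-> zero < y.
Proof.
  intros Hx Hy. split; intros H.
  - destruct (lt_or_le zero y) as [|K]; inR. exfalso.
    apply (le_not_lt (x + y) x); inR.
    rewrite <- (add_0 x) at 2 by inR. apply le_add2; inR; now right.
  - rewrite <- (add_0 x) at 1 by inR. rewrite !(add_comm x) by inR. now apply lt_add; inR.
Qed.

Lemma mul_0 x : x ∊ R -> x * zero = zero.
Proof.
  intros Hx. apply (add_cancel _ _ (x * zero)); inR.
  rewrite <- mul_add, add_0, add_comm, add_0; inR.
Qed.

(** If 1 were negative, -1 would be positive, and so would its square 1. *)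
Lemma lt_0_1 : zero < one.
Proof.
  destruct (lt_total zero one) as [H|[H|H]]; inR; [now apply zero_neq_one in H|].
  destruct (opp_ex one one_in) as (n & Hn & En).
  assert (pn : zero < n).
  { apply (lt_add _ _ n) in H; inR. rewrite En, add_comm, add_0 in H; inR. }
  replace one with (n * n); [now apply mul_pos|].
  apply (add_cancel _ _ n); inR. rewrite En.
  rewrite <- (mul_1 n) at 3 by inR. rewrite <- mul_add, (add_comm n), En, mul_0; inR.
Qed.

Lemma half_ex x : x ∊ R -> exists y, y ∊ R /\ y + y = x.
Proof.
  intros Hx. destruct (inv_ex (one + one)) as (h & Hh & Eh); inR.
  - intros H. apply (lt_irrefl zero zero_in). rewrite <- H at 2.
    apply lt_trans with one; inR; [apply lt_0_1 | apply lt_add_pos; inR; apply lt_0_1].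
  - assert (hh : h + h = one).
    { rewrite <- Eh, mul_comm, mul_add, mul_1; inR. }
    exists (x * h); split; inR. rewrite <- mul_add, hh, mul_1; inR.
Qed.

Definition midpoint r s m : Prop := m ∊ R /\ m + m = r + s.

Lemma midpoint_ex r s : r ∊ R -> s ∊ R -> exists m, midpoint r s m.
Proof. intros; apply half_ex; inR. Qed.

Lemma midpoint_between r s m : r ∊ R -> s ∊ R -> r < s -> midpoint r s m -> r < m /\ m < s.
Proof.
  intros Hr Hs H [Hm Em]. split.
  - destruct (lt_or_le r m) as [|K]; inR. exfalso.
    apply (lt_irrefl (m + m)); inR. rewrite Em at 2.
    apply le_lt_trans with (r + r); inR; [now apply le_add2|].
    rewrite (add_comm r s) by inR. now apply lt_add.
  - destruct (lt_or_le m s) as [|K]; inR. exfalso.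
    apply (lt_irrefl (m + m)); inR. rewrite Em at 1.
    apply lt_le_trans with (s + s); inR; [now apply lt_add | now apply le_add2].
Qed.

Lemma midpoint_unique r s m m' : midpoint r s m -> midpoint r s m' -> m = m'.
Proof.
  intros [Hm Em] [Hm' Em']. rewrite <- Em' in Em.
  destruct (lt_total m m') as [H|[H|H]]; inR; exfalso.
  - apply (lt_irrefl (m + m)); inR. rewrite Em at 2. apply lt_add2; inR; now left.
  - apply (lt_irrefl (m + m)); inR. rewrite Em at 1. apply lt_add2; inR; now left.
Qed.

Lemma sup_ex S b : Subset S R -> (exists x, x ∊ S) -> b ∊ R -> Upper_bound lt S b ->
  exists s, s ∊ R /\ Upper_bound lt S s /\
    forall b, b ∊ R -> Upper_bound lt S b -> s <= b.
Proof.
  intros HS [x Hx] Hb Ub. destruct real_line as (_ & _ & _ & _ & C). apply C; eauto.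
  intros N; exact (N x Hx).
Qed.

Lemma def_ap f g h :
  definable_fun g -> definable_fun h -> definable_fun (fun rho => ap f (g rho) (h rho)).
Proof.
  apply (def_fun2 (ap f)). unfold ap, Op. apply (def_iota
    (fun z rho => pair (pair (rho 0) (rho 1)) z ∊ f)).
  definability.
Qed.

(** Repeated halving without counting.  Let [p] be the midpoint of [c] and [a],
    at distance [eps] from both.  If no interval lay between [c] and [a],
    every interval around [p] would have length at least [eps].  The numbers [d]
    such that every interval around [p] has length at least [d] form a bounded
    set that is closed under doubling, because one half of an interval around
    [p] is again around [p]; such a set cannot contain a positive number. *)
Lemma bisection_dense (I : M -> M -> Prop) :
  definable (fun rho => I (rho 0) (rho 1)) ->
  (forall r s, I r s -> r ∊ R /\ s ∊ R /\ r < s) ->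
  I zero one ->
  (forall r s m, I r s -> midpoint r s m -> I r m /\ I m s) ->
  forall c a, c ∊ R -> a ∊ R -> zero <= c -> c < a -> a <= one ->
  exists r s, I r s /\ c < r /\ s < a.
Proof.
  intros DI HI I01 halve c a Hc Ha c0 ca a1.
  destruct (midpoint_ex c a Hc Ha) as [p Mp].
  destruct (midpoint_between c a p Hc Ha ca Mp) as [cp pa]. destruct Mp as [Hp Ep].
  destruct (sub_ex c p Hc Hp) as (eps & He & Ee).
  assert (Ee' : p + eps = a).
  { apply (add_cancel _ _ c); inR. rewrite (add_comm a), <- Ep, add_assoc by inR.
    rewrite (add_comm eps), Ee; inR. }
  assert (eps0 : zero < eps).
  { apply (lt_add_pos c); inR. now rewrite Ee. }
  apply NNPP; intros N.
  set (J := fun r s => I r s /\ r <= p /\ p < s).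
  assert (J_long : forall r s, J r s -> r + eps <= s).
  { intros r s (Irs & rp & ps). destruct (HI r s Irs) as (Hr & Hs & _).
    destruct (lt_or_le c r) as [cr|rc]; inR.
    - destruct (lt_or_le s a) as [sa|sa]; inR; [exfalso; apply N; eauto|].
      apply le_trans with a; inR. rewrite <- Ee'. now apply le_add.
    - apply le_trans with p; inR; [|now left]. rewrite <- Ee. now apply le_add. }
  set (short := fun d => d ∊ R /\ forall r s, J r s -> r + d <= s).
  assert (D : definable (fun rho => short (rho 0))).
  { unfold short, J, Le. definability.
    all: try exact (def_rename _ (1 .: fun _ => 0) DI).
    all: apply (def_ap add (fun rho => rho 1) (fun rho => rho 2)); definability. }
  destruct (separation short R D) as [S HS].
  assert (HS' : forall d, d ∊ S <-> short d) by (intros d; rewrite HS; unfold short; tauto).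
  destruct (sup_ex S one) as (sigma & Hsig & Ub & Least).
  - intros d Hd; now apply HS'.
  - exists eps; now apply HS'.
  - inR.
  - intros d [Hd K]%HS'. rewrite <- (add_0 d), add_comm by inR. apply K.
    split; [exact I01|]. split.
    + apply le_trans with c; inR; now left.
    + now apply lt_le_trans with a; inR.
  - assert (sig0 : zero < sigma).
    { apply lt_le_trans with eps; inR. apply Ub, HS'; now split. }
    (* half of [sigma] is not an upper bound, hence [sigma] is less than some [d + d] *)
    destruct (half_ex sigma Hsig) as (h & Hh & Eh).
    assert (hs : h < sigma).
    { destruct (lt_or_le h sigma) as [|K]; inR. exfalso.
      assert (h0 : zero < h) by (apply lt_le_trans with sigma; inR).
      apply (le_not_lt sigma h); inR. rewrite <- Eh. now apply lt_add_pos. }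
    assert (K : ~ Upper_bound lt S h).
    { intros K%Least; [|inR]. now apply le_not_lt in K. }
    apply K; intros d Sd. pose proof (proj1 (HS' d) Sd) as [Hd Ld].
    destruct (lt_or_le h d) as [hd|]; inR. exfalso.
    apply (le_not_lt (d + d) sigma); inR.
    + (* [d + d] is again a lower bound for the lengths: use the half that contains [p]. *)
      apply Ub, HS'. split; inR. intros r s (Irs & rp & ps).
      destruct (HI r s Irs) as (Hr & Hs & rs).
      destruct (midpoint_ex r s Hr Hs) as [m Mm].
      destruct (halve r s m Irs Mm) as [Irm Ims]. destruct Mm as [Hm Em].
      assert (dd : (r + d) + (r + d) = (r + (d + d)) + r).
      { rewrite add_swap, (add_comm (r + r)), <- add_assoc, (add_comm (d + d)) by inR.
        reflexivity. }
      destruct (lt_or_le p m) as [pm|mp]; inR.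
      * apply (le_add_inv _ _ r); inR. rewrite <- dd, (add_comm s), <- Em by inR.
        apply le_add2; inR; apply Ld; repeat split; auto.
      * apply (le_add_inv _ _ s); inR.
        rewrite (add_assoc r), (add_comm (d + d)), <- add_assoc, <- Em, add_swap by inR.
        apply le_add2; inR; apply Ld; repeat split; auto.
    + rewrite <- Eh. apply lt_add2; inR; now left.
Qed.

(** * The dyadic tree of closed pairs *)

Definition fst p : M := iota (fun x => exists y, p = pair x y).
Definition snd p : M := iota (fun y => exists x, p = pair x y).

Lemma fst_pair x y : fst (pair x y) = x.
Proof. apply iota_eq; [now exists y | intros z [w H]; inj H; congruence]. Qed.

Lemma snd_pair x y : snd (pair x y) = y.
Proof. apply iota_eq; [now exists x | intros z [w H]; inj H; congruence]. Qed.

Section Urysohn.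

Variables (X mu : M).
Hypothesis gentop : Is_gentop X mu.

Definition compl V : M := class (fun x => x ∊ X /\ ~ x ∊ V).

Lemma in_compl V x : x ∊ compl V <-> x ∊ X /\ ~ x ∊ V.
Proof.
  apply (in_class_sub (fun x => x ∊ X /\ ~ x ∊ V) X); [definability | tauto].
Qed.

Lemma open_sub U x : U ∊ mu -> x ∊ U -> x ∊ X.
Proof. intros HU. exact (proj1 gentop U HU x). Qed.

Lemma compl_closed V : V ∊ mu -> Closed_in X mu (compl V).
Proof.
  intros HV. split; [intros x Hx; now apply in_compl in Hx|].
  exists V; split; [exact HV|]. intros x. rewrite in_compl.
  pose proof (open_sub V x HV). generalize (classic (x ∊ V)); tauto.
Qed.

Lemma compl_open C : Closed_in X mu C -> compl C ∊ mu.
Proof.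
  intros (_ & U & HU & D). replace (compl C) with U; [exact HU|].
  apply set_ext; intros x. rewrite in_compl. apply D.
Qed.

Lemma union_open (Q : M -> Prop) :
  definable (fun rho => Q (rho 0)) -> (forall U, Q U -> U ∊ mu) ->
  exists W, W ∊ mu /\ forall x, x ∊ W <-> exists U, Q U /\ x ∊ U.
Proof.
  intros D HQ.
  assert (HC : forall U, U ∊ class Q <-> Q U) by (intros U; now apply in_class_sub with mu).
  destruct (proj2 gentop (class Q)) as (W & HW & UW).
  - intros U HU. now apply HQ, HC.
  - exists W; split; [exact HW|]. intros x. transitivity (exists U, U ∊ class Q /\ x ∊ U); [apply UW|].
    split; intros (U & HU & xU); exists U; (split; [now apply HC | exact xU]).
Qed.

Definition Closed_pair C D := Closed_in X mu C /\ Closed_in X mu D /\ Disjoint C D.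

(** [F] is the graph of the function that witnesses effective normality. *)
Variable F : M.
Hypothesis separates : forall C D, Closed_pair C D -> exists V W,
  pair (pair C D) (pair V W) ∊ F /\ (forall q, pair (pair C D) q ∊ F -> q = pair V W) /\
  V ∊ mu /\ W ∊ mu /\ Disjoint V W /\ Subset C V /\ Subset D W.

(** The interval with end points [r], [s] together with the disjoint closed sets
    [C] and [D], which the Urysohn function is to separate on this interval. *)
Definition node r s C D : M := pair (pair r s) (pair C D).
Definition lo t : M := fst (fst t).
Definition hi t : M := snd (fst t).
Definition lower t : M := fst (snd t).
Definition upper t : M := snd (snd t).

Lemma lo_node r s C D : lo (node r s C D) = r.
Proof. unfold lo, node; now rewrite !fst_pair. Qed.
Lemma hi_node r s C D : hi (node r s C D) = s.
Proof. unfold hi, node; now rewrite fst_pair, snd_pair. Qed.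
Lemma lower_node r s C D : lower (node r s C D) = C.
Proof. unfold lower, node; now rewrite snd_pair, fst_pair. Qed.
Lemma upper_node r s C D : upper (node r s C D) = D.
Proof. unfold upper, node; now rewrite !snd_pair. Qed.

Definition mid t : M := iota (fun m => midpoint (lo t) (hi t) m).
(** The pair of open sets that [F] chooses for the closed pair of [t]. *)
Definition opens t : M := iota (fun q => pair (snd t) q ∊ F).
Definition left t : M := node (lo t) (mid t) (lower t) (compl (fst (opens t))).
Definition right t : M := node (mid t) (hi t) (compl (snd (opens t))) (upper t).

Definition good t : Prop :=
  t = node (lo t) (hi t) (lower t) (upper t) /\ lo t ∊ R /\ hi t ∊ R /\
  zero <= lo t /\ lo t < hi t /\ hi t <= one /\ Closed_pair (lower t) (upper t).

Definition nested t u : Prop :=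
  lo t <= lo u /\ hi u <= hi t /\ Subset (lower t) (lower u) /\ Subset (upper t) (upper u).

(** The interval of [t] lies to the left of that of [u], and accordingly the
    open complement of [upper t] is contained in the closed set [lower u]. *)
Definition before t u : Prop :=
  hi t <= lo u /\ forall x, x ∊ X -> x ∊ upper t \/ x ∊ lower u.

Lemma good_node r s C D :
  good (node r s C D) <-> r ∊ R /\ s ∊ R /\ zero <= r /\ r < s /\ s <= one /\ Closed_pair C D.
Proof.
  unfold good. rewrite lo_node, hi_node, lower_node, upper_node. tauto.
Qed.

(** The left child replaces the upper set by the complement of [V], the right
    child the lower set by the complement of [W]; these two complements cover
    [X] because [V] and [W] are disjoint, whence [before]. *)
Lemma children t : good t ->
  good (left t) /\ good (right t) /\ nested t (left t) /\ nested t (right t) /\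
  before (left t) (right t) /\ lo (left t) = lo t /\ hi (right t) = hi t /\
  hi (left t) = mid t /\ lo (right t) = mid t /\ midpoint (lo t) (hi t) (mid t).
Proof.
  intros (Et & Hr & Hs & r0 & rs & s1 & HCD).
  assert (Mm : midpoint (lo t) (hi t) (mid t)).
  { destruct (midpoint_ex (lo t) (hi t) Hr Hs) as [m Mm].
    replace (mid t) with m; [exact Mm|]. symmetry; apply iota_eq; [exact Mm|].
    intros m' Mm'; exact (midpoint_unique _ _ _ _ Mm' Mm). }
  destruct (midpoint_between _ _ _ Hr Hs rs Mm) as [rm ms].
  destruct (separates _ _ HCD) as (V & W & HF & UF & HV & HW & VW & CV & DW).
  assert (Eo : opens t = pair V W).
  { apply iota_eq; replace (snd t) with (pair (lower t) (upper t)); auto;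
      rewrite Et at 3; unfold node; now rewrite snd_pair. }
  destruct HCD as (HC & HD & CD).
  unfold left, right, nested, before. rewrite Eo, fst_pair, snd_pair.
  rewrite !good_node, !lo_node, !hi_node, !lower_node, !upper_node.
  pose proof (proj1 Mm) as Hm.
  repeat split; try assumption; try (now left); try (now right); try (now apply compl_closed);
    try apply HC; try apply HD; try apply Mm; try (intros x Hx; exact Hx).
  - now apply le_trans with (hi t); inR; left.
  - intros (x & xC & xV). apply in_compl in xV. now apply xV, CV.
  - now apply le_trans with (lo t); inR; left.
  - intros (x & xW & xD). apply in_compl in xW. now apply xW, DW.
  - intros x xD. apply in_compl; split; [now apply HD|]. intros xV.
    apply VW; exists x; split; [exact xV | now apply DW].
  - intros x xC. apply in_compl; split; [now apply HC|]. intros xW.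
    apply VW; exists x; split; [now apply CV | exact xW].
  - intros x xX. rewrite !in_compl.
    destruct (classic (x ∊ V)) as [xV|xV]; [right|left]; split; try exact xX; try exact xV.
    intros xW; apply VW; now exists x.
Qed.

Lemma nested_refl t : nested t t.
Proof. repeat split; try (now right); now intros x. Qed.

Lemma nested_trans t u v : good t -> good u -> good v ->
  nested t u -> nested u v -> nested t v.
Proof.
  intros (_ & Ht & Ht' & _) (_ & Hu & Hu' & _) (_ & Hv & Hv' & _)
    (H1 & H2 & H3 & H4) (K1 & K2 & K3 & K4).
  repeat split.
  - now apply le_trans with (lo u).
  - now apply le_trans with (hi u).
  - intros x Hx; now apply K3, H3.
  - intros x Hx; now apply K4, H4.
Qed.

Lemma before_nested t u t' u' : good t -> good u -> good t' -> good u' ->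
  before t u -> nested t t' -> nested u u' -> before t' u'.
Proof.
  intros (_ & _ & Ht & _) (_ & Hu & _) (_ & _ & Ht' & _) (_ & Hu' & _)
    [H K] (_ & H1 & _ & K1) (H2 & _ & K2 & _).
  split.
  - apply le_trans with (hi t); inR. now apply le_trans with (lo u).
  - intros x xX. destruct (K x xX); auto.
Qed.

Definition stable Z : Prop := forall t, t ∊ Z -> left t ∊ Z /\ right t ∊ Z.

(** Membership in the least set that contains [t] and is closed under children.
    The quantifier over sets replaces a recursion along finite paths; [nodes]
    ensures that it does not range over the empty collection. *)
Definition descends t u : Prop := forall Z, t ∊ Z -> stable Z -> u ∊ Z.

Lemma descends_refl t : descends t t.
Proof. now intros Z. Qed.

Lemma descends_left t u : descends t u -> descends t (left u).
Proof. intros H Z tZ S. exact (proj1 (S u (H Z tZ S))). Qed.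

Lemma descends_right t u : descends t u -> descends t (right u).
Proof. intros H Z tZ S. exact (proj2 (S u (H Z tZ S))). Qed.

Ltac tree_definability :=
  unfold good, nested, before, descends, stable, left, right, mid, opens, midpoint,
    Closed_pair, Closed_in, Is_diff, Disjoint, Subset, compl, node, lo, hi, lower, upper,
    fst, snd, Le;
  repeat (definability_step || match goal with
    |- definable_fun (fun rho => ap ?f (@?g rho) (@?h rho)) => apply (def_ap f g h) end).

Lemma def_descends g h : definable_fun g -> definable_fun h ->
  definable (fun rho => descends (g rho) (h rho)).
Proof. apply (def_rel descends). tree_definability. Qed.

(** A set to carry out separation in, so that [descends] admits induction over
    definable predicates. *)
Definition nodes : M := class good.

Lemma in_nodes t : t ∊ nodes <-> good t.
Proof.
  apply (in_class_sub good (prod (prod R R) (prod (power X) (power X)))).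
  - tree_definability.
  - intros u (Eu & Hr & Hs & _ & _ & _ & (HC & _) & (HD & _) & _).
    rewrite Eu. unfold node. rewrite !pair_in_prod, !in_power. auto.
Qed.

Lemma descends_ind (Q : M -> Prop) t :
  definable (fun rho => Q (rho 0)) -> good t -> Q t ->
  (forall u, good u -> Q u -> Q (left u) /\ Q (right u)) ->
  forall u, descends t u -> good u /\ Q u.
Proof.
  intros D Gt Qt IH u H. destruct (separation Q nodes D) as [Z HZ].
  rewrite <- in_nodes. apply HZ, H.
  - apply HZ; now rewrite in_nodes.
  - intros v [Gv Qv]%HZ. rewrite in_nodes in Gv.
    destruct (children v Gv) as (Gl & Gr & _). destruct (IH v Gv Qv).
    split; apply HZ; now rewrite in_nodes.
Qed.

Lemma descends_good t u : good t -> descends t u -> good u.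
Proof.
  intros Gt H. apply (descends_ind (fun _ => True) t); try tauto.
  apply def_ext with (fun _ => False -> False); [tauto|].
  apply def_imp; apply def_false.
Qed.

Lemma descends_nested t u : good t -> descends t u -> nested t u.
Proof.
  intros Gt H. apply (descends_ind (fun u => nested t u) t).
  - tree_definability.
  - exact Gt.
  - apply nested_refl.
  - intros v Gv N. destruct (children v Gv) as (Gl & Gr & Nl & Nr & _).
    split; now apply nested_trans with v.
  - exact H.
Qed.

(** The right-hand side contains [t] and is closed under children. *)
Lemma descends_inv t u : good t -> descends t u ->
  u = t \/ descends (left t) u \/ descends (right t) u.
Proof.
  intros Gt H.
  apply (descends_ind (fun u => u = t \/ descends (left t) u \/ descends (right t) u) t).
  - tree_definability.
  - exact Gt.
  - now left.
  - intros v _ [->|[K|K]].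
    + split; right; [left | right]; apply descends_refl.
    + split; right; left; [now apply descends_left | now apply descends_right].
    + split; right; right; [now apply descends_left | now apply descends_right].
  - exact H.
Qed.

Definition comparable t u : Prop :=
  descends t u \/ descends u t \/ before t u \/ before u t.

(** When [u] is a proper descendant of [t] it descends from one of the children,
    and is then separated from the other one. *)
Lemma comparable_children t u : good t -> good u -> comparable t u ->
  comparable (left t) u /\ comparable (right t) u.
Proof.
  intros Gt Gu. destruct (children t Gt) as (Gl & Gr & Nl & Nr & B & _).
  intros [H|[H|[H|H]]].
  - destruct (descends_inv t u Gt H) as [->|[K|K]].
    + split; right; left; [apply descends_left | apply descends_right]; apply descends_refl.
    + split; [now left|]. right; right; right.
      apply (before_nested (left t) (right t)); auto using nested_refl, descends_nested.
    + split; [|now left]. right; right; left.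
      apply (before_nested (left t) (right t)); auto using nested_refl, descends_nested.
  - split; right; left; [now apply descends_left | now apply descends_right].
  - split; right; right; left; apply (before_nested t u); auto using nested_refl.
  - split; right; right; right; apply (before_nested u t); auto using nested_refl.
Qed.

Variables A B : M.
Hypothesis AB : Closed_pair A B.

Definition root : M := node zero one A B.

Lemma good_root : good root.
Proof.
  apply good_node. repeat split; inR; try apply AB; [now right | apply lt_0_1 | now right].
Qed.

Definition tree t : Prop := descends root t.

Lemma def_tree g : definable_fun g -> definable (fun rho => tree (g rho)).
Proof. intros Hg. apply def_descends; [apply def_param | exact Hg]. Qed.

Lemma tree_good t : tree t -> good t.
Proof. apply descends_good, good_root. Qed.

Lemma tree_comparable t u : tree t -> tree u -> comparable t u.
Proof.
  intros Ht Hu. revert Hu. revert u.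
  apply (descends_ind (fun t => forall u, tree u -> comparable t u) root); try exact Ht.
  - apply (def_all (fun u rho => tree u -> comparable (rho 0) u)), def_imp.
    + apply def_tree, def_var.
    + unfold comparable. repeat (apply def_or || apply def_descends); tree_definability.
  - apply good_root.
  - intros u Hu; now left.
  - intros v Gv IH; split; intros u Hu;
      apply (comparable_children v u Gv (tree_good u Hu) (IH u Hu)).
Qed.

(** * The Urysohn function *)

(** Off [upper t] the function is to be at most [hi t], off [lower u] at least
    [lo u]; a point where both apply must not receive contradictory bounds. *)
Lemma tree_monotone t u x : tree t -> tree u -> x ∊ X ->
  ~ x ∊ upper t -> ~ x ∊ lower u -> lo u <= hi t.
Proof.
  intros Tt Tu xX xt xu.
  pose proof (tree_good t Tt) as Gt; pose proof (tree_good u Tu) as Gu.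
  destruct (tree_comparable t u Tt Tu) as [H|[H|[H|H]]].
  - apply descends_nested in H as (_ & H & _); [|exact Gt].
    destruct Gt as (_ & Ht & Ht' & _ & lt_t & _), Gu as (_ & Hu & Hu' & _ & lt_u & _).
    apply le_trans with (hi u); inR. now left.
  - apply descends_nested in H as (H & _); [|exact Gu].
    destruct Gt as (_ & Ht & Ht' & _ & lt_t & _), Gu as (_ & Hu & Hu' & _ & lt_u & _).
    apply le_trans with (lo t); inR. now left.
  - destruct H as [_ H]. destruct (H x xX); contradiction.
  - destruct H as [H _].
    destruct Gt as (_ & Ht & Ht' & _ & lt_t & _), Gu as (_ & Hu & Hu' & _ & lt_u & _).
    apply le_trans with (hi u); inR; [now left|].
    apply le_trans with (lo t); inR. now left.
Qed.

Lemma tree_dense c a : c ∊ R -> a ∊ R -> zero <= c -> c < a -> a <= one ->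
  exists t, tree t /\ c < lo t /\ hi t < a.
Proof.
  intros Hc Ha c0 ca a1.
  destruct (bisection_dense (fun r s => exists t, tree t /\ lo t = r /\ hi t = s))
    with (c := c) (a := a) as (r & s & (t & Tt & <- & <-) & H); eauto.
  - apply (def_ex (fun t rho => tree t /\ lo t = rho 0 /\ hi t = rho 1)), def_and.
    + apply def_tree, def_var.
    + tree_definability.
  - intros r s (t & Tt & <- & <-). apply tree_good in Tt as (_ & Hr & Hs & _ & H & _); auto.
  - exists root. unfold root; rewrite lo_node, hi_node. repeat split. apply descends_refl.
  - intros r s m (t & Tt & <- & <-) Mm.
    destruct (children t (tree_good t Tt)) as (_ & _ & _ & _ & _ & El & Er & El' & Er' & Mm').
    rewrite (midpoint_unique _ _ _ _ Mm Mm').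
    split; [exists (left t) | exists (right t)]; repeat split; auto;
      [now apply descends_left | now apply descends_right].
Qed.

Definition value_bound x b : Prop :=
  zero <= b /\ forall t, tree t -> ~ x ∊ lower t -> lo t <= b.

Definition value x : M := iota (fun y =>
  y ∊ R /\ value_bound x y /\ forall b, b ∊ R -> value_bound x b -> y <= b).

Lemma def_value_bound g h : definable_fun g -> definable_fun h ->
  definable (fun rho => value_bound (g rho) (h rho)).
Proof.
  apply (def_rel value_bound). unfold value_bound, Le.
  repeat (definability_step || apply def_tree || (progress (unfold lo, lower, fst, snd))).
Qed.

Lemma def_value g : definable_fun g -> definable_fun (fun rho => value (g rho)).
Proof.
  intros Hg. apply (def_fun2 (fun x _ => value x) g g); try exact Hg. unfold value, Le.
  repeat (definability_step || apply def_value_bound).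
Qed.

Lemma value_bound_one x : value_bound x one.
Proof.
  split; [left; apply lt_0_1|]. intros t Tt _.
  apply tree_good in Tt as (_ & Hr & Hs & _ & rs & s1 & _).
  apply le_trans with (hi t); inR. now left.
Qed.

(** The supremum is obtained from the set of lower bounds of all the bounds
    [b], which needs no description of the values that nodes impose. *)
Lemma value_spec x :
  value x ∊ R /\ value_bound x (value x) /\
  forall b, b ∊ R -> value_bound x b -> value x <= b.
Proof.
  set (S := class (fun r => r ∊ R /\ forall b, b ∊ R -> value_bound x b -> r <= b)).
  assert (HS : forall r, r ∊ S <-> r ∊ R /\ forall b, b ∊ R -> value_bound x b -> r <= b).
  { intros r. apply (in_class_sub
      (fun r => r ∊ R /\ forall b, b ∊ R -> value_bound x b -> r <= b) R); [|tauto].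
    unfold Le. repeat (definability_step || apply def_value_bound). }
  destruct (sup_ex S one) as (y & Hy & Ub & Least).
  - intros r Hr; now apply HS.
  - exists zero. apply HS; split; inR. now intros b _ [H _].
  - inR.
  - intros r [Hr H]%HS. apply H; inR. apply value_bound_one.
  - assert (L : y ∊ R /\ value_bound x y /\ forall b, b ∊ R -> value_bound x b -> y <= b).
    { split; [exact Hy|]. split; [split|].
      - apply Ub, HS; split; inR. now intros b _ [H _].
      - intros t Tt xt. apply Ub, HS. split; [now apply tree_good|].
        intros b _ [_ H]. now apply H.
      - intros b Hb Bb. apply Least; [exact Hb|]. intros r [_ H]%HS. now apply H. }
    replace (value x) with y; [exact L|]. symmetry; apply iota_eq; [exact L|].
    destruct L as (_ & By & Ly). intros z (Hz & Bz & Lz). apply le_antisym; auto.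
Qed.

Lemma value_in x : value x ∊ R.
Proof. apply value_spec. Qed.

Hint Resolve value_in : reals.

Lemma value_ge_0 x : zero <= value x.
Proof. apply value_spec. Qed.

Lemma value_le_1 x : value x <= one.
Proof. apply value_spec; [inR | apply value_bound_one]. Qed.

Lemma value_gt a x : a ∊ R -> zero <= a ->
  (a < value x <-> exists t, tree t /\ a < lo t /\ ~ x ∊ lower t).
Proof.
  intros Ha a0. split.
  - intros H. apply NNPP; intros N.
    apply (le_not_lt (value x) a); inR. apply value_spec; [exact Ha|].
    split; [exact a0|]. intros t Tt xt.
    destruct (lt_or_le a (lo t)) as [K|K]; inR; [now apply tree_good|].
    exfalso; apply N; eauto.
  - intros (t & Tt & at_ & xt). destruct (tree_good t Tt) as (_ & Ht & _).
    apply lt_le_trans with (lo t); inR. now apply value_spec.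
Qed.

(** From left to right: density gives a node between [value x] and [a]; as its
    left end exceeds [value x], the point [x] lies in its lower set, hence
    not in its upper set.  From right to left this is [tree_monotone]. *)
Lemma value_lt a x : x ∊ X -> a ∊ R -> a <= one ->
  (value x < a <-> exists t, tree t /\ hi t < a /\ ~ x ∊ upper t).
Proof.
  intros xX Ha a1. split.
  - intros H. destruct (tree_dense (value x) a) as (t & Tt & ct & ta); inR;
      [apply value_ge_0|].
    exists t; split; [exact Tt|]. split; [exact ta|].
    destruct (tree_good t Tt) as (_ & Ht & _ & _ & _ & _ & _ & _ & CD).
    intros xD. apply (le_not_lt (lo t) (value x)); inR.
    apply value_spec; [exact Tt|]. intros xC. apply CD; now exists x.
  - intros (t & Tt & ta & xt).
    destruct (tree_good t Tt) as (_ & Ht & Ht' & t0 & tt & _).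
    apply le_lt_trans with (hi t); inR. apply value_spec; [exact Ht'|]. split.
    + apply le_trans with (lo t); inR. now left.
    + intros u Tu xu. now apply (tree_monotone t u x).
Qed.

Lemma value_A x : x ∊ A -> value x = zero.
Proof.
  intros xA. apply le_antisym; inR; [|apply value_ge_0].
  apply value_spec; inR. split; [now right|]. intros t Tt xt. exfalso; apply xt.
  apply (descends_nested root t good_root Tt). unfold root; now rewrite lower_node.
Qed.

Lemma value_B x : x ∊ B -> value x = one.
Proof.
  intros xB. apply le_antisym; inR; [apply value_le_1|].
  destruct (lt_or_le (value x) one) as [H|H]; inR. exfalso.
  destruct AB as (_ & HB & _). assert (xX : x ∊ X) by now apply HB.
  apply value_lt in H as (t & Tt & _ & xt); inR; [|now right].
  apply xt, (descends_nested root t good_root Tt). unfold root; now rewrite upper_node.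
Qed.

Definition graph : M := class (fun p => exists x, x ∊ X /\ p = pair x (value x)).

Lemma in_graph p : p ∊ graph <-> exists x, x ∊ X /\ p = pair x (value x).
Proof.
  apply (in_class_sub (fun p => exists x, x ∊ X /\ p = pair x (value x)) (prod X R)).
  - repeat (definability_step || apply def_value).
  - intros q (x & xX & ->). apply pair_in_prod; split; inR.
Qed.

Lemma pair_in_graph x y : pair x y ∊ graph <-> x ∊ X /\ y = value x.
Proof.
  rewrite in_graph; split; [|intros [xX ->]; eauto].
  intros (z & zX & H); inj H; now subst.
Qed.

Lemma graph_function : Is_function graph X R.
Proof.
  split.
  - intros p (x & xX & ->)%in_graph. exists x; split; [exact xX|].
    exists (value x); split; inR.
  - intros x xX. exists (value x). split; inR. rewrite pair_in_graph.
    split; [tauto|]. intros z Hz; now apply pair_in_graph in Hz.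
Qed.

Lemma graph_preimage W V : (forall x, x ∊ W <-> x ∊ X /\ value x ∊ V) ->
  Is_preimage W graph X V.
Proof.
  intros H x. rewrite H. split.
  - intros [xX xV]; split; [exact xX|]. exists (value x). now rewrite pair_in_graph.
  - intros (xX & y & yV & K%pair_in_graph). destruct K as [_ ->]; tauto.
Qed.

Lemma empty_open : exists W, W ∊ mu /\ forall x, ~ x ∊ W.
Proof.
  destruct (union_open (fun _ => False)) as (W & HW & H); [apply def_false | tauto |].
  exists W; split; [exact HW|]. intros x (U & [] & _)%H.
Qed.

Lemma union2_open U V : U ∊ mu -> V ∊ mu ->
  exists W, W ∊ mu /\ forall x, x ∊ W <-> x ∊ U \/ x ∊ V.
Proof.
  intros HU HV. destruct (union_open (fun W => W = U \/ W = V)) as (W & HW & H).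
  - definability.
  - intros W [->| ->]; assumption.
  - exists W; split; [exact HW|]. intros x. rewrite H. split.
    + intros (Z & [->| ->] & xZ); auto.
    + intros [K|K]; eauto.
Qed.

(** [X] itself is open as the union of the complements of [A] and [B]; without
    a disjoint pair of closed sets this may fail. *)
Lemma space_open : X ∊ mu.
Proof.
  destruct AB as (HA & HB & H).
  destruct (union2_open _ _ (compl_open A HA) (compl_open B HB)) as (W & HW & K).
  replace X with W; [exact HW|]. apply set_ext; intros x. rewrite K, !in_compl.
  split; [tauto|]. intros xX. destruct (classic (x ∊ A)) as [xA|xA]; [right|left]; auto.
  split; [exact xX|]. intros xB; apply H; eauto.
Qed.

Lemma value_gt_open a : a ∊ R -> exists W, W ∊ mu /\ forall x, x ∊ W <-> x ∊ X /\ a < value x.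
Proof.
  intros Ha. destruct (lt_or_le a zero) as [H|H]; inR.
  - exists X; split; [apply space_open|]. intros x; split; [|tauto]. intros xX.
    split; [exact xX|]. apply lt_le_trans with zero; inR. apply value_ge_0.
  - destruct (union_open (fun U => exists t, tree t /\ a < lo t /\ U = compl (lower t)))
      as (W & HW & K).
    + repeat (definability_step || apply def_tree
        || (progress (unfold compl, lo, lower, fst, snd))).
    + intros U (t & Tt & _ & ->). apply compl_open, tree_good, Tt.
    + exists W; split; [exact HW|]. intros x. rewrite K, value_gt by assumption. split.
      * intros (U & (t & Tt & ta & ->) & xU%in_compl). split; [tauto|]. exists t; tauto.
      * intros (xX & t & Tt & ta & xt). exists (compl (lower t)). rewrite in_compl. eauto 6.
Qed.

Lemma value_lt_open a : a ∊ R -> exists W, W ∊ mu /\ forall x, x ∊ W <-> x ∊ X /\ value x < a.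
Proof.
  intros Ha. destruct (lt_or_le one a) as [H|H]; inR.
  - exists X; split; [apply space_open|]. intros x; split; [|tauto]. intros xX.
    split; [exact xX|]. apply le_lt_trans with one; inR. apply value_le_1.
  - destruct (union_open (fun U => exists t, tree t /\ hi t < a /\ U = compl (upper t)))
      as (W & HW & K).
    + repeat (definability_step || apply def_tree
        || (progress (unfold compl, hi, upper, fst, snd))).
    + intros U (t & Tt & _ & ->). apply compl_open, tree_good, Tt.
    + exists W; split; [exact HW|]. intros x. rewrite K. split.
      * intros (U & (t & Tt & ta & ->) & xU%in_compl). split; [tauto|].
        apply value_lt; [tauto..|]. exists t; tauto.
      * intros (xX & L). apply value_lt in L as (t & Tt & ta & xt); try assumption.
        exists (compl (upper t)). rewrite in_compl. eauto 6.
Qed.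

Lemma graph_continuous T : Is_gtau_n R lt T -> Continuous graph X mu R T.
Proof.
  intros HT. split; [apply graph_function|]. intros V HV.
  cut (exists W, W ∊ mu /\ forall x, x ∊ W <-> x ∊ X /\ value x ∊ V).
  { intros (W & HW & K); exists W; split; [exact HW | now apply graph_preimage]. }
  apply HT in HV as [HV|[->|[(a & Ha & HV)|[(a & Ha & HV)|(a & Ha & b & Hb & _ & HV)]]]].
  - destruct empty_open as (W & HW & K). exists W; split; [exact HW|].
    intros x; split; intros H; [now apply K in H | destruct H as [_ H]; now apply HV in H].
  - exists X; split; [apply space_open|]. intros x; split; [|tauto]. intros xX; split; inR.
  - destruct (value_lt_open a Ha) as (W & HW & K). exists W; split; [exact HW|].
    intros x. rewrite K, (HV (value x)). pose proof (value_in x); tauto.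
  - destruct (value_gt_open a Ha) as (W & HW & K). exists W; split; [exact HW|].
    intros x. rewrite K, (HV (value x)). pose proof (value_in x); tauto.
  - destruct (value_lt_open a Ha) as (W1 & HW1 & K1).
    destruct (value_gt_open b Hb) as (W2 & HW2 & K2).
    destruct (union2_open W1 W2 HW1 HW2) as (W & HW & K). exists W; split; [exact HW|].
    intros x. rewrite K, K1, K2, (HV (value x)). pose proof (value_in x); tauto.
Qed.

Lemma graph_fiber C r : Subset C X -> (forall x, x ∊ C -> value x = r) ->
  Sub_fiber C graph X r.
Proof.
  intros HC H. exists (upair r r), (class (fun x => x ∊ X /\ value x = r)).
  assert (K : forall x, x ∊ class (fun x => x ∊ X /\ value x = r) <-> x ∊ X /\ value x = r).
  { intros x. apply (in_class_sub (fun x => x ∊ X /\ value x = r) X); [|tauto].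
    repeat (definability_step || apply def_value). }
  split; [|split].
  - intros z. rewrite in_upair; tauto.
  - apply graph_preimage. intros x. rewrite K, in_upair; tauto.
  - intros x xC. apply K; auto.
Qed.

End Urysohn.

Theorem urysohn T X mu :
  Is_gtau_n R lt T -> Is_gentop X mu -> Effectively_normal X mu ->
  Gul X mu R zero one T.
Proof.
  intros HT top (P & O & F & HP & HO & [_ FF] & HF) A B HA HB AB.
  assert (separates : forall C D, Closed_pair X mu C D -> exists V W,
    pair (pair C D) (pair V W) ∊ F /\ (forall q, pair (pair C D) q ∊ F -> q = pair V W) /\
    V ∊ mu /\ W ∊ mu /\ Disjoint V W /\ Subset C V /\ Subset D W).
  { intros C D (HC & HD & CD).
    assert (PCD : pair C D ∊ P) by (apply HP; eauto 6).
    destruct (FF _ PCD) as (q & (V & W & -> & HV & HW & VW)%HO & Fq & U).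
    destruct (HF _ PCD _ Fq C D V W); eauto. exists V, W; auto 8. }
  assert (HAB : Closed_pair X mu A B) by (split; auto).
  exists (graph X F A B). split; [|split].
  - now apply graph_continuous.
  - apply (graph_fiber X mu top F separates A B HAB); [apply HA|].
    intros x; eapply value_A; eassumption.
  - apply (graph_fiber X mu top F separates A B HAB); [apply HB|].
    intros x; eapply value_B; eassumption.
Qed.

End RealLine.

End Model.

Theorem theorem3p4 :
  ZF_proves
    (∀ R zero one add mul lt T,
       is_real_line R zero one add mul lt ⟶ is_gtau_n R lt T ⟶
       ∀ X mu, is_gentop X mu ⟶ effectively_normal X mu ⟶
         GUL X mu R zero one T).
Proof.
  apply completeness; intros M E M_ZF rho.
  apply (read_urysohn M E (rho 0) M_ZF).
  intros R zero one add mul lt T HR HT X mu. eapply urysohn; eassumption.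
Qed.
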